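(* Let $K$ be a nonarchimedean local field of characteristic zero, $E/K$ an elliptic curve with good reduction, $X=E-\{\infty\}$ given by $y^2=4x^3-60e_4x-140e_6$, $\alpha=dx/y$, $\beta=x\,dx/y$, and $b\in X(K)$. Let $$\nabla_{KZB}=d-\beta B-\alpha\exp\left(-\sum_{k=2}^\infty\frac{(-1)^kP_k\,\mathrm{ad}_B^k}{k}\right)(A)$$ be the KZB connection on $\mathcal{O}_X\langle\langle A,B\rangle\rangle$ with marked element $1$ in the fibre over $b$. The Hodge filtration $F^\bullet$ on $\nabla_{KZB}$ is $$F^j\mathcal{O}_X\langle\langle A,B\rangle\rangle=\mathrm{Span}_{\mathcal{O}_X}\left\{\text{words }w\text{ in }A,B\text{ such that }\deg_Aw\le -j\right\}.$$
   Context: Lie elements act on $\mathcal{O}_X\langle\langle A,B\rangle\rangle$ by left multiplication; spans are understood at each finite level: a subscript $n$ denotes the quotient by words of degree $>n$. Functions $P_k$: fix an embedding $K\hookrightarrow\mathbb{C}$, let $z=\int_\infty\alpha$ be the Abel–Jacobi coordinate and $x=\wp(z)=z^{-2}+\sum_{n\ge1}(2n+1)e_{2n+2}z^{2n}$; put $e_2=0$ and $e_n=0$ for $n$ odd. For $k\ge 2$, $P_k$ is the regular algebraic function on $X$ which is the pullback of $\frac{(-1)^k}{(k-1)!}\frac{d^{k-2}\wp}{dz^{k-2}}-e_k$. The connection $\nabla_{KZB}$ with marked element $1$ represents the universal pointed unipotent connection on $X$. Logarithmic extension: fix a meromorphic function $f$ on $E$ with $df-\beta$ holomorphic at $\infty$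 and $f=-z^{-1}+O(z)$; let $Y\subset E$ be the open subset obtained by removing the poles of $f$ other than $\infty$. On $Y$ let $\nabla_{KZB}'=d-(\beta-df)B-\alpha\exp\left(-f\,\mathrm{ad}_B-\sum_{k\ge2}\frac{(-1)^kP_k\mathrm{ad}_B^k}{k}\right)(A)$. The gauge transformation $g=\exp(-fB)$ (left multiplication) glues $\nabla_{KZB}$ on $X$ to $\nabla_{KZB}'$ on $Y$, giving a logarithmic connection $\overline{\nabla}=(\nabla_{KZB},\nabla_{KZB}',g)$ on $E$ with logarithmic pole at $\infty$, the logarithmic extension of $\nabla_{KZB}$. A logarithmic filtration on a logarithmic connection $(\mathscr{E},\nabla)$ on $E$ with poles along $\infty$ is a finite decreasing exhaustive and separated filtration of $\mathscr{E}$ by subbundles $F^i\mathscr{E}$ satisfying Griffiths transversality $\nabla(F^i\mathscr{E})\subseteq F^{i-1}\mathscr{E}\otimes\Omega^1_{E/K}(\log\infty)$; in the pointed case the marked element must lie in $(F^0\mathscr{E})_b$. The Hodge filtration on a representative of the universal pointed connection (characterised by a lemma of Hadian) is the restriction to $X$ of the filtration on the logarithmic extension $\overline{\nabla}$ by pointed logarithmic filtrations for which, for all $n$, the exact sequence $$0\to V_{dR}^{\otimes n}\otimes\mathcal{O}_E\to\overline{\nabla}_n\to\overline{\nabla}_{n-1}\to0$$ is an exact sequence of filtered pointed logarithmic connections. Here $V_{dR}=H_1^{dR}(X/K)$ has basis $A,B$ dual to $\alpha,\beta$, $V_{dR}^{\otimes n}$ is identified with the span of words of degree $n$, and $F^{-j}(V_{dR}^{\otimes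 n}\otimes\mathcal{O}_E)$ is, for $-j\le 0$, the $\mathcal{O}_E$-span of the words $w$ of degree $n$ with $\deg_Aw\le j$, and $0$ for $-j>0$. This filtration is unique up to unique isomorphism. *)

(* Defs.v *)
From HB Require Import structures.
From mathcomp Require Import all_boot all_order all_algebra.
From mathcomp Require Import boolp classical_sets functions fsbigop.

Set Implicit Arguments.
Unset Strict Implicit.
Unset Printing Implicit Defensive.

Import Order.TTheory GRing.Theory Num.Theory.
Local Open Scope classical_set_scope.
Local Open Scope ring_scope.

Section LocalField.
Variables (K : fieldType) (v : K -> int).

(* The value [v 0] is junk: 0 has valuation +oo. *)
Definition val_ge (N : int) (a : K) : Prop := a = 0 \/ N <= v a.

(* Complete for a normalized discrete valuation, with finite residue field. *)
Record nonarch_local_field : Prop := NonarchLocalField {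
  val_mul : forall a c, a != 0 -> c != 0 -> v (a * c) = v a + v c;
  val_add : forall N a c, val_ge N a -> val_ge N c -> val_ge N (a + c);
  val_uniformizer : exists2 pi, pi != 0 & v pi = 1;
  val_complete : forall u : nat -> K,
    (forall N, exists m0 : nat, forall m m' : nat, (m0 <= m)%N -> (m0 <= m')%N ->
       val_ge N (u m - u m')) ->
    exists l, forall N, exists m0 : nat, forall m : nat, (m0 <= m)%N ->
      val_ge N (u m - l);
  val_residue_finite : exists s : seq K, forall a, val_ge 0 a ->
    exists2 c, c \in s & val_ge 1 (a - c) }.

Definition weierstrass_disc (a1 a2 a3 a4 a6 : K) : K :=
  let b2 := a1 ^+ 2 + 4 * a2 in
  let b4 := 2 * a4 + a1 * a3 in
  let b6 := a3 ^+ 2 + 4 * a6 in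
  let b8 := a1 ^+ 2 * a6 + 4 * a2 * a6 - a1 * a3 * a4 + a2 * a3 ^+ 2 - a4 ^+ 2 in
  - b2 ^+ 2 * b8 - 8 * b4 ^+ 3 - 27 * b6 ^+ 2 + 9 * b2 * b4 * b6.

(* Some admissible change of variables x = u^2 X + r, y / 2 = u^3 Y + s u^2 X + t
   takes y^2 = 4 x^3 - 60 e4 x - 140 e6 to an integral Weierstrass equation with
   unit discriminant.  As K is infinite, the identity of polynomials is stated
   on values. *)
Definition good_reduction (e4 e6 : K) : Prop :=
  exists u r s t a1 a2 a3 a4 a6 : K,
  [/\ u != 0,
      [/\ val_ge 0 a1, val_ge 0 a2, val_ge 0 a3, val_ge 0 a4 & val_ge 0 a6],
      weierstrass_disc a1 a2 a3 a4 a6 != 0 /\ v (weierstrass_disc a1 a2 a3 a4 a6) = 0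
    & forall X Y : K,
      (2 * (u ^+ 3 * Y + s * u ^+ 2 * X + t)) ^+ 2
        - (4 * (u ^+ 2 * X + r) ^+ 3 - 60 * e4 * (u ^+ 2 * X + r) - 140 * e6)
      = 4 * u ^+ 6 * (Y ^+ 2 + a1 * X * Y + a3 * Y
                      - (X ^+ 3 + a2 * X ^+ 2 + a4 * X + a6))].

End LocalField.

(* A formal Laurent series over K in the variable z is its coefficient function
   int -> K, vanishing below some bound. *)
Section Laurent.
Variable K : fieldType.
Implicit Types a c : int -> K.

Definition laurent_bounded a : Prop := exists N : int, forall i, i < N -> a i = 0.

(* Finitely many nonzero terms when a and c are bounded below. *)
Definition laurent_mul a c : int -> K :=
  fun i => \sum_(j \in [set: int]) a j * c (i - j).

Definition laurent_const (k : K) : int -> K := fun i => if i == 0 then k else 0.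

Definition laurent_deriv a : int -> K := fun i => (i + 1)%:~R * a (i + 1).

(* z^-2 + \sum_(n >= 1) (2n+1) e_(2n+2) z^(2n) *)
Definition wp_series (e : nat -> K) : int -> K := fun i =>
  match i with
  | Posz m => if (0 < m)%N && ~~ odd m then m.+1%:R * e m.+2 else 0
  | Negz m => if m == 1%N then 1 else 0
  end.

End Laurent.

(* p(a, c), the outer variable of p being the second one. *)
Definition bieval (R : nzRingType) (p : {poly {poly R}}) (a c : R) : R := p.[c%:P].[a].

(* The elliptic curve y^2 = 4 x^3 - 60 e_4 x - 140 e_6 through its function field L,
   the space Omega of meromorphic differentials, and the Laurent expansion of
   functions at infinity in the formal coordinate z = \int_oo alpha.  Every field
   is determined by (e_4, e_6) up to unique isomorphism. *)
Record weierstrass_curve (K : fieldType) := WeierstrassCurve {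
  ec_e : nat -> K;
  ec_L : fieldType;
  ec_iota : {rmorphism K -> ec_L};
  ec_x : ec_L;
  ec_y : ec_L;
  ec_Omega : lmodType ec_L;
  ec_d : ec_L -> ec_Omega;
  ec_laurent : ec_L -> int -> K;

  ec_e2 : ec_e 2 = 0;
  ec_eodd : forall n, odd n -> ec_e n = 0;
  ec_nonsingular : (60 * ec_e 4) ^+ 3 - 27 * (140 * ec_e 6) ^+ 2 != 0;

  ec_equation : ec_y ^+ 2
    = 4 * ec_x ^+ 3 - ec_iota (60 * ec_e 4) * ec_x - ec_iota (140 * ec_e 6);
  ec_transcendental : forall q : {poly K}, root (map_poly ec_iota q) ec_x -> q = 0;
  ec_generated : forall h : ec_L, exists p q : {poly {poly K}},
    bieval (map_poly (map_poly ec_iota) q) ec_x ec_y != 0 /\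
    h = bieval (map_poly (map_poly ec_iota) p) ec_x ec_y
        / bieval (map_poly (map_poly ec_iota) q) ec_x ec_y;

  ec_d_add : forall h k, ec_d (h + k) = ec_d h + ec_d k;
  ec_d_mul : forall h k, ec_d (h * k) = h *: ec_d k + k *: ec_d h;
  ec_d_const : forall c, ec_d (ec_iota c) = 0;
  ec_dx_neq0 : ec_d ec_x != 0;
  ec_dx_span : forall om, exists h, om = h *: ec_d ec_x;

  ec_laurent_bounded : forall h, laurent_bounded (ec_laurent h);
  ec_laurent_const : forall c, ec_laurent (ec_iota c) = laurent_const c;
  ec_laurent_add : forall h k i,
    ec_laurent (h + k) i = ec_laurent h i + ec_laurent k i;
  ec_laurent_mul : forall h k,
    ec_laurent (h * k) = laurent_mul (ec_laurent h) (ec_laurent k);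
  ec_laurent_x : ec_laurent ec_x = wp_series ec_e;
  (* dz = alpha: if dh = k alpha, with alpha = dx / y, then k is the z-derivative of h *)
  ec_laurent_d : forall h k, ec_d h = k *: (ec_y^-1 *: ec_d ec_x) ->
    ec_laurent k = laurent_deriv (ec_laurent h) }.

Definition span (L : nzRingType) (V : lmodType L) (R : set L) (G : set V) : set V :=
  [set u | exists (m : nat) (c : 'I_m -> L) (g : 'I_m -> V),
     [/\ forall i, R (c i), forall i, G (g i) & u = \sum_i c i *: g i]].

Section Curve.
Variables (K : fieldType) (C : weierstrass_curve K).
Local Notation L := (ec_L C).
Local Notation Omega := (ec_Omega C).
Local Notation iota := (@ec_iota K C).
Local Notation x := (ec_x C).
Local Notation y := (ec_y C).
Local Notation d := (@ec_d K C).
Local Notation laurent := (@ec_laurent K C).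

Definition alpha : Omega := y^-1 *: d x.
Definition beta : Omega := x *: alpha.

Definition eval_xy (p : {poly {poly K}}) : L := bieval (map_poly (map_poly iota) p) x y.

Definition coord_ring : set L := [set h | exists p, h = eval_xy p].

Record is_maximal_ideal (m : set L) : Prop := IsMaximalIdeal {
  max_sub : m `<=` coord_ring;
  max_0 : m 0;
  max_add : forall h k, m h -> m k -> m (h + k);
  max_mul : forall h k, coord_ring h -> m k -> m (h * k);
  max_proper : ~ m 1;
  max_max : forall h, coord_ring h -> ~ m h -> exists2 k, coord_ring k & m (1 - h * k) }.

Record affine_point := AffinePoint {
  point_ideal : set L;
  point_idealP : is_maximal_ideal point_ideal }.

(* Closed points of E: [None] is the point at infinity. *)
Definition point := option affine_point.

Definition stalk (Q : point) : set L :=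
  match Q with
  | None => [set h | forall i, i < 0 -> laurent h i = 0]
  | Some m => [set h | exists a s,
                 [/\ coord_ring a, coord_ring s, ~ point_ideal m s & h = a / s]]
  end.

Definition kaehler_stalk (Q : point) : set Omega := span (stalk Q) (d @` stalk Q).

(* Differentials with a pole of order at most one at infinity: those multiplied
   into the regular ones by the functions vanishing at infinity. *)
Definition log_stalk (Q : point) : set Omega :=
  match Q with
  | None => [set om | forall t, (forall i, i <= 0 -> laurent t i = 0) ->
                kaehler_stalk None (t *: om)]
  | Some m => kaehler_stalk (Some m)
  end.

Definition sections (U : set point) : set L := [set h | forall Q, U Q -> stalk Q h].
Definition log_sections (U : set point) : set Omega :=
  [set om | forall Q, U Q -> log_stalk Q om].

Definition opX : set point := [set Q | Q <> None].
Definition opY (f : L) : set point := [set Q | Q = None \/ stalk Q f].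

Definition on_curve (b1 b2 : K) : Prop :=
  b2 ^+ 2 = 4 * b1 ^+ 3 - 60 * ec_e C 4 * b1 - 140 * ec_e C 6.

(* h is regular at the point (b1, b2) and takes the value c there. *)
Definition value_at (b1 b2 : K) (h : L) (c : K) : Prop :=
  exists p q, [/\ bieval q b1 b2 != 0, h = eval_xy p / eval_xy q
                & c = bieval p b1 b2 / bieval q b1 b2].

(* P_k is the regular function on X with the same Laurent expansion in z as
   (-1)^k / (k-1)! (d/dz)^(k-2) wp - e_k. *)
Definition is_P (P : nat -> L) : Prop := forall k, (2 <= k)%N ->
  sections opX (P k) /\
  forall i, laurent (P k) i
    = (-1) ^+ k / (k.-1)`!%:R * iter (k - 2) (@laurent_deriv K) (wp_series (ec_e C)) i
      - laurent_const (ec_e C k) i.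

Definition is_f (f : L) : Prop :=
  [/\ kaehler_stalk None (d f - beta),
      forall i, i < -1 -> laurent f i = 0,
      laurent f (-1) = -1
    & laurent f 0 = 0].

(* The letters A, B are true, false. *)
Definition letter := bool.
Definition word := seq letter.
Definition degA (w : word) : nat := count_mem true w.

(* Noncommutative series in A, B with coefficients in V. *)
Definition series (V : lmodType L) := word -> V.
Local Notation ncs := (series L^o).

Definition monomial (w : word) : ncs := fun w' => if w' == w then 1 else 0.
Definition serA : ncs := monomial [:: true].
Definition serB : ncs := monomial [:: false].

Definition ncmul (V : lmodType L) (a : ncs) (u : series V) : series V := fun w =>
  \sum_(i < (size w).+1) (a (take i w) : L) *: u (drop i w).

Definition ad_B (u : ncs) : ncs := ncmul serB u - ncmul u serB.

(* \sum_(k >= 1) c_k ad_B^k, the terms with k > |w| not contributing to the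
   coefficient of w; the same applies to the exponentials below. *)
Definition ad_series (c : nat -> L) (u : ncs) : ncs := fun w =>
  \sum_(1 <= k < (size w).+1) c k * iter k ad_B u w.

Definition exp_ad (c : nat -> L) (u : ncs) : ncs := fun w =>
  \sum_(m < (size w).+1) (m`!%:R)^-1 * iter m (ad_series c) u w.

Definition coefX (P : nat -> L) (k : nat) : L :=
  if (2 <= k)%N then - ((-1) ^+ k * P k / k%:R) else 0.
Definition coefY (P : nat -> L) (f : L) (k : nat) : L :=
  if k == 1%N then - f else coefX P k.

(* The forms om for which nabla_KZB and nabla_KZB' are u |-> du - om u. *)
Definition kzb_form (P : nat -> L) : series Omega := fun w =>
  (serB w : L) *: beta + (exp_ad (coefX P) serA w : L) *: alpha.
Definition kzb_form' (P : nat -> L) (f : L) : series Omega := fun w =>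
  (serB w : L) *: (beta - d f) + (exp_ad (coefY P f) serA w : L) *: alpha.

(* g = exp(-f B) *)
Definition gauge (f : L) : ncs := fun w =>
  \sum_(m < (size w).+1)
    (m`!%:R)^-1 * iter m (fun u : ncs => ncmul ((- f) *: serB) u) (monomial [::]) w.

(* Level n, the quotient by words of degree > n, is modelled by the series
   supported on words of degree <= n. *)
Definition trunc (V : lmodType L) (n : nat) (u : series V) : series V :=
  fun w => if (size w <= n)%N then u w else 0.

Definition level (R : set L) (n : nat) : set ncs :=
  [set u : ncs | (forall w, R (u w)) /\ trunc n u = u].

Definition connection (om : series Omega) (n : nat) (u : ncs) : series Omega :=
  trunc n (fun w => d (u w) -
    \sum_(i < (size w).+1) (u (drop i w) : L) *: om (take i w)).

(* The submodule F (x) W of Omega-valued series. *)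
Definition tensor (R : set L) (F : set ncs) (W : set Omega) : set (series Omega) :=
  span R [set t | exists u om, [/\ F u, W om & t = (fun w => (u w : L) *: om)]].

Record is_submodule (R : set L) (M F : set ncs) : Prop := IsSubmodule {
  submod_sub : F `<=` M;
  submod_0 : F 0;
  submod_add : forall u u', F u -> F u' -> F (u + u');
  submod_scale : forall c u, R c -> F u -> F (c *: u) }.

(* On an affine open, a subbundle is a direct summand of the module of sections. *)
Definition is_subbundle (R : set L) (M F : set ncs) : Prop :=
  is_submodule R M F /\
  exists G, [/\ is_submodule R M G, forall u, F u -> G u -> u = 0
              & forall u, M u -> exists u1 u2, [/\ F u1, G u2 & u = u1 + u2]].

(* Logarithmic filtrations of d - om on the level n bundle over the affine open U. *)
Record log_filtration_on (U : set point) (om : series Omega) (n : nat)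
    (F : int -> set ncs) : Prop := LogFiltrationOn {
  lf_subbundle : forall j, is_subbundle (sections U) (level (sections U) n) (F j);
  lf_decreasing : forall j k, j <= k -> F k `<=` F j;
  lf_exhaustive : exists j, F j = level (sections U) n;
  lf_separated : exists j, F j = [set 0];
  lf_transverse : forall j u, F j u ->
    tensor (sections U) (F (j - 1)) (log_sections U) (connection om n u) }.

(* Pointed logarithmic filtrations of the level n logarithmic extension: a
   filtration F over X and a filtration F' over Y (both are affine) which the
   gauge transformation g identifies over their intersection. *)
Record pointed_log_filtration (P : nat -> L) (f : L) (b1 b2 : K) (n : nat)
    (F F' : int -> set ncs) : Prop := PointedLogFiltration {
  plf_X : log_filtration_on opX (kzb_form P) n F;
  plf_Y : log_filtration_on (opY f) (kzb_form' P f) n F';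
  plf_glue : forall j,
    span (sections (opX `&` opY f)) [set trunc n (ncmul (gauge f) u) | u in F j]
    = span (sections (opX `&` opY f)) (F' j);
  plf_pointed : exists2 u, F 0 u &
    forall w, value_at b1 b2 (u w) (if w == [::] then 1 else 0) }.

(* The sections over U of F^j(V_dR^{(x) n} (x) O_E); for j > 0 no word qualifies. *)
Definition tensor_power_fil (U : set point) (n : nat) (j : int) : set ncs :=
  span (sections U)
    [set monomial w | w in [set w | size w = n /\ (degA w)%:Z <= - j]].

(* Exactness in every filtration degree of
   0 -> V_dR^{(x) n} (x) O_E -> nabla_n -> nabla_(n-1) -> 0 over U;
   for n = 0 the quotient is 0. *)
Definition filtered_exact (U : set point) (F : nat -> int -> set ncs) : Prop :=
  (forall n j, F n j `&` [set u | forall w, size w <> n -> u w = 0]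
               = tensor_power_fil U n j) /\
  (forall n j, [set trunc n u | u in F n.+1 j] = F n j).

(* F is the restriction to X of filtrations (F, F') of the logarithmic extension. *)
Definition is_hodge_filtration (P : nat -> L) (f : L) (b1 b2 : K)
    (F : nat -> int -> set ncs) : Prop :=
  exists F' : nat -> int -> set ncs,
    [/\ forall n, pointed_log_filtration P f b1 b2 n (F n) (F' n),
        filtered_exact opX F & filtered_exact (opY f) F'].

Definition word_filtration (n : nat) (j : int) : set ncs :=
  span (sections opX)
    [set monomial w | w in [set w | (size w <= n)%N /\ (degA w)%:Z <= - j]].

End Curve.

(* Main.v *)
Require Import Defs.
From mathcomp Require Import all_boot all_order all_algebra.
From mathcomp Require Import boolp classical_sets functions fsbigop.
From mathcomp Require Import zify ring.
Import Defs.

(* Existence is a computation with words. At infinity, writing z^-1 up to high order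
   as a function t, the exponent in nabla_KZB' is log(1 + t T) + O(z) in T = ad_B, so
   its exponential has at most a simple pole.
   Uniqueness goes by induction on the level n. A Hodge filtration of level n + 1 is
   the graph of linear maps phi on X and phi' on Y, indexed by the words v of degree
   n + 1, from the span of shorter words w with deg_A w < deg_A v to functions. The
   gauge exp(-f B) relates phi(w) to phi'(w), phi'(Bw), ..., and E has no function with
   a single simple pole: hence phi'(Bw) = 0, and phi = phi' is constant. Griffiths
   transversality then gives phi(Aw) = 0 and the marked element gives phi(1) = 0. *)

Set Implicit Arguments.
Unset Strict Implicit.
Unset Printing Implicit Defensive.

Import Order.TTheory GRing.Theory Num.Theory.
Local Open Scope classical_set_scope.
Local Open Scope ring_scope.

(** * Laurent expansions at infinity *)

Section LaurentExpansion.
Variables (K : fieldType) (C : weierstrass_curve K).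
Local Notation L := (ec_L C).
Local Notation iota := (@ec_iota K C).
Local Notation laurent := (@ec_laurent K C).
Implicit Types (h k : L) (c : K) (i m n M N : int).

(** Subtracting [e_k] removes the constant term of the k-th derivative function, so
    [P_k = z^-k + O(z)]. The terms k >= 2 of the exponent are therefore those of log(1 + T/z) up to
    O(z), and [-f = z^-1 + O(z)], normalised without constant term, supplies the missing linear one.
    No logarithm of series is formed: the coefficients of an exponential obey a linear recursion,
    and dividing by 1 + t T turns it into one whose coefficients are O(z). For uniqueness, exactness
    fixes the kernel and the induction fixes the quotient, so only the extension between them is
    open. Neither chart settles it alone: [phi] is controlled away from infinity and [phi'] near
    infinity. The words Bw, Aw and 1 are excluded by three different conditions, namely gluing,
    transversality and the marked element. The first two need descending induction on the length of
    w, since the relation at w involves longer words. *)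

Lemma laurent_mul_single (a b : int -> K) i n :
  (forall j, j != n -> a j * b (i - j) = 0) ->
  laurent_mul a b i = a n * b (i - n).
Proof.
move=> H; rewrite /laurent_mul.
rewrite -(@fsbig_widen _ _ _ _ [set n] setT) ?fsbig_set1 // => j [_ /= jn].
by apply: H; apply/eqP.
Qed.

Lemma laurent0 i : laurent 0 i = 0.
Proof. by rewrite -(rmorph0 iota) ec_laurent_const /laurent_const; case: ifP. Qed.

Lemma laurent1 i : laurent 1 i = if i == 0 then 1 else 0.
Proof. by rewrite -(rmorph1 iota) ec_laurent_const. Qed.

Lemma laurentN h i : laurent (- h) i = - laurent h i.
Proof.
by apply/eqP; rewrite -addr_eq0 -ec_laurent_add addNr laurent0.
Qed.

Lemma laurentB h k i : laurent (h - k) i = laurent h i - laurent k i.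
Proof. by rewrite ec_laurent_add laurentN. Qed.

(* h = c z^n + O(z^M) *)
Definition expands h n c M : Prop :=
  forall i, i < M -> laurent h i = if i == n then c else 0.

Definition ord_ge h N : Prop := forall i, i < N -> laurent h i = 0.

(** In degrees below [N] only the index [j = n] of the convolution survives: any other [j < M] kills
    the first factor, and [j >= M] pushes [i - j] below [n'], where the second factor vanishes. *)
Lemma expands_mul h n c M h' n' c' M' N :
  expands h n c M -> expands h' n' c' M' -> n <= M -> n' <= M' ->
  N <= n + M' -> N <= n' + M -> expands (h * h') (n + n') (c * c') N.
Proof.
move=> Eh Eh' nM nM' N1 N2 i iN; rewrite ec_laurent_mul.
rewrite (@laurent_mul_single _ _ i n) => [|j jn].
  rewrite (Eh' (i - n)); last lia.
  have [ein|ein] := eqVneq i (n + n').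
    have -> : (i - n == n') by lia.
    by rewrite (Eh n) ?eqxx //; lia.
  have -> : (i - n == n') = false by lia.
  by rewrite mulr0.
have [jM|jM] := ltP j M; first by rewrite Eh // (negbTE jn) mul0r.
by rewrite Eh' ?mulr0; [case: eqP => [|_]; [lia|rewrite mulr0]|lia].
Qed.

Lemma expands_ord_ge h n c M N :
  expands h n c M -> N <= n -> N <= M -> ord_ge h N.
Proof. by move=> H Nn NM i iN; rewrite H; [case: eqP => //; lia|lia]. Qed.

Lemma ord_ge_expands h n c : ord_ge h n -> expands h n c n.
Proof. by move=> H i iN; rewrite H //; case: eqP => //; lia. Qed.

Lemma ord_ge_expandsS h n : ord_ge h n -> expands h n (laurent h n) (n + 1).
Proof.
by move=> H i iN; case: eqP => [->//|ni]; apply: H; lia.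
Qed.

Lemma ord_ge_le h N M : ord_ge h N -> M <= N -> ord_ge h M.
Proof. by move=> H MN i iM; apply: H; lia. Qed.

Lemma ord_ge0 N : ord_ge 0 N.
Proof. by move=> i _; rewrite laurent0. Qed.

Lemma ord_ge_const c : ord_ge (iota c) 0.
Proof. by move=> i i0; rewrite ec_laurent_const /laurent_const; case: eqP => //; lia. Qed.

Lemma ord_ge_add h k N : ord_ge h N -> ord_ge k N -> ord_ge (h + k) N.
Proof. by move=> H H' i iN; rewrite ec_laurent_add H // H' // addr0. Qed.

Lemma ord_ge_opp h N : ord_ge h N -> ord_ge (- h) N.
Proof. by move=> H i iN; rewrite laurentN H // oppr0. Qed.

Lemma ord_ge_sum (I : Type) (r : seq I) (p : pred I) (F : I -> L) N :
  (forall a, p a -> ord_ge (F a) N) -> ord_ge (\sum_(a <- r | p a) F a) N.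
Proof.
by move=> H; elim/big_ind: _ => //; [exact: ord_ge0|move=> *; exact: ord_ge_add].
Qed.

Lemma ord_ge_mul h k N M : ord_ge h N -> ord_ge k M -> ord_ge (h * k) (N + M).
Proof.
move=> H H'; apply: (@expands_ord_ge _ (N + M) (0 * 0) (N + M)) => //.
by apply: expands_mul => //; (try exact: ord_ge_expands); rewrite // addrC.
Qed.

Lemma laurent_mul_lead h k N M : ord_ge h N -> ord_ge k M ->
  laurent (h * k) (N + M) = laurent h N * laurent k M.
Proof.
move=> /ord_ge_expandsS H /ord_ge_expandsS H'.
have E : expands (h * k) (N + M) (laurent h N * laurent k M) (N + M + 1).
  by apply: (expands_mul H H'); lia.
by rewrite E ?eqxx //; lia.
Qed.

Lemma ord_ge_constM c h N : ord_ge h N -> ord_ge (iota c * h) N.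
Proof. by rewrite -{2}(add0r N); apply: ord_ge_mul; exact: ord_ge_const. Qed.

Lemma laurent_constM c h i : laurent (iota c * h) i = c * laurent h i.
Proof.
rewrite ec_laurent_mul ec_laurent_const (@laurent_mul_single _ _ _ 0).
  by rewrite /laurent_const eqxx subr0.
by move=> j; rewrite /laurent_const => /negbTE ->; rewrite mul0r.
Qed.

(** The expansion is injective because functions form a field: if all coefficients of [h] vanished,
    so would those of [h / h = 1]. *)
Lemma laurent_neq0 h : h != 0 -> exists2 n, ord_ge h n & laurent h n != 0.
Proof.
move=> h0; have [N HN] := ec_laurent_bounded h.
have [i0 hi0] : exists i, laurent h i != 0.
  apply: contrapT => H.
  have {}H i : laurent h i = 0.
    by apply: contrapT => /eqP hi; apply: H; exists i.
  have : laurent (h / h) 0 = 1 by rewrite divff // laurent1.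
  rewrite ec_laurent_mul (@laurent_mul_single _ _ _ 0) => [|j _]; rewrite H mul0r //.
  by move/esym/eqP; rewrite oner_eq0.
have E : exists n : nat, laurent h (N + n%:Z) != 0.
  exists `|i0 - N|%N; have [iN|iN] := ltP i0 N; first by rewrite HN ?eqxx in hi0.
  by have -> : N + `|i0 - N|%N%:Z = i0 by lia.
case: (ex_minnP E) => m hm mmin; exists (N + m%:Z) => // i im.
have [iN|iN] := ltP i N; first exact: HN.
apply: contrapT => /eqP hi; have := mmin `|i - N|%N.
have -> : N + `|i - N|%N%:Z = i by lia.
by move=> /(_ hi); lia.
Qed.

Lemma laurent_inv h n : ord_ge h n -> laurent h n != 0 ->
  ord_ge h^-1 (- n) /\ laurent h^-1 (- n) = (laurent h n)^-1.
Proof.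
move=> H hn; have h0 : h != 0.
  by apply: contraNneq hn => ->; rewrite laurent0.
have [m Hm hm] : exists2 n, ord_ge h^-1 n & laurent h^-1 n != 0.
  by apply: laurent_neq0; rewrite invr_eq0.
have := laurent_mul_lead H Hm; rewrite divff // laurent1.
case: eqP => [nm e|_ e]; last by move/esym/eqP: e; rewrite mulf_eq0 (negbTE hn) (negbTE hm).
have -> : - n = m by lia.
by split => //; apply: (mulfI hn); rewrite -e divff.
Qed.

(** Powers keep the relative precision [M - n]. *)
Lemma expands_exp h n c M (j : nat) : n <= M ->
  expands h n c M -> expands (h ^+ j) (n *+ j) (c ^+ j) (n *+ j + M - n).
Proof.
move=> nM Eh; elim: j => [|j IH].
  rewrite !expr0 mulr0n => i _; exact: laurent1.
rewrite !exprS mulrS; apply: (expands_mul Eh IH) => //; lia.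
Qed.

Lemma laurent_coef_neq0 h n : laurent h n != 0 -> h != 0.
Proof. by apply: contraNneq => ->; rewrite laurent0. Qed.

Lemma laurent_exp_lead h n (j : nat) : ord_ge h n ->
  ord_ge (h ^+ j) (n *+ j) /\ laurent (h ^+ j) (n *+ j) = laurent h n ^+ j.
Proof.
move=> H; have n1 : n <= n + 1 by lia.
have E := @expands_exp _ _ _ _ j n1 (ord_ge_expandsS H).
split; first by apply: (expands_ord_ge E); lia.
by rewrite E ?eqxx //; lia.
Qed.

(* A function of order one at infinity corrects one coefficient at a time. *)
Lemma approx_monomial s h n N : ord_ge s 1 -> laurent s 1 != 0 ->
  ord_ge h n -> laurent h n = 1 -> exists t, expands t n 1 N.
Proof.
move=> s1 s10 hn h1.
suff H (j : nat) : exists t, expands t n 1 (n + 1 + j%:Z).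
  have [t Et] := H `|N - n|%N; exists t => i iN; apply: Et; lia.
elim: j => [|j [t Et]].
  by exists h; rewrite addr0 -h1; exact: ord_ge_expandsS.
set m := n + 1 + j%:Z in Et.
(* A function of exact order [m]: a power of [s], inverted when [m] is negative, then rescaled by a
   constant. *)
have [s' Es' s'm] : exists2 s', ord_ge s' m & laurent s' m = 1.
  have [p [p1 p2]] : exists p, ord_ge p m /\ laurent p m != 0.
    have [m0|m0] := leP 0 m.
      exists (s ^+ `|m|); have [A B] := laurent_exp_lead `|m| s1.
      have e : 1 *+ `|m| = m :> int by lia.
      by rewrite e in A B; rewrite B expf_neq0.
    have [A B] := laurent_exp_lead `|m| s1.
    have e : 1 *+ `|m| = - m :> int by lia.
    rewrite e in A B; have [|A' B'] := laurent_inv A; first by rewrite B expf_neq0.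
    by exists (s ^+ `|m|)^-1; rewrite opprK in A' B'; rewrite B' B invr_neq0 ?expf_neq0.
  exists (iota (laurent p m)^-1 * p); first exact: ord_ge_constM.
  by rewrite laurent_constM mulVf.
exists (t - iota (laurent t m) * s') => i im.
have cs : ord_ge (iota (laurent t m) * s') m by exact: ord_ge_constM.
rewrite laurentB; have [{}im|mi] := ltP i m.
  by rewrite cs // subr0 Et.
have -> : i = m by move: im; rewrite /m; lia.
rewrite laurent_constM s'm mulr1 subrr.
by case: eqP => //; rewrite /m; lia.
Qed.

End LaurentExpansion.

(** * The coordinate ring and poles at infinity *)

Section BivariateEvaluation.
Variables (R : comNzRingType) (a b : R).
Implicit Types p q : {poly {poly R}}.

Lemma bievalD p q : bieval (p + q) a b = bieval p a b + bieval q a b.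
Proof. by rewrite /bieval !hornerD. Qed.

Lemma bievalM p q : bieval (p * q) a b = bieval p a b * bieval q a b.
Proof. by rewrite /bieval !hornerM. Qed.

Lemma bievalB p q : bieval (p - q) a b = bieval p a b - bieval q a b.
Proof. by rewrite /bieval !hornerE. Qed.

Lemma bievalC (r : {poly R}) : bieval r%:P a b = r.[a].
Proof. by rewrite /bieval hornerC. Qed.

Lemma bievalX : bieval 'X a b = b.
Proof. by rewrite /bieval hornerX hornerC. Qed.

End BivariateEvaluation.

Section CoordinateRing.
Variables (K : fieldType) (C : weierstrass_curve K).
Local Notation L := (ec_L C).
Local Notation iota := (@ec_iota K C).
Local Notation x := (ec_x C).
Local Notation y := (ec_y C).
Local Notation coord_ring := (@coord_ring K C).
Implicit Types (p q : {poly {poly K}}) (r : {poly K}) (h k : L).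

Definition cubic : {poly K} :=
  4 *: 'X^3 - (60 * ec_e C 4) *: 'X - (140 * ec_e C 6)%:P.

Lemma eval_xyD p q : eval_xy C (p + q) = eval_xy C p + eval_xy C q.
Proof. by rewrite /eval_xy rmorphD /= bievalD. Qed.

Lemma eval_xyM p q : eval_xy C (p * q) = eval_xy C p * eval_xy C q.
Proof. by rewrite /eval_xy rmorphM /= bievalM. Qed.

Lemma eval_xyB p q : eval_xy C (p - q) = eval_xy C p - eval_xy C q.
Proof. by rewrite /eval_xy rmorphB /= bievalB. Qed.

Lemma eval_xyP r : eval_xy C r%:P = (map_poly iota r).[x].
Proof. by rewrite /eval_xy map_polyC /= bievalC. Qed.

Lemma eval_xyC c : eval_xy C c%:P%:P = iota c.
Proof. by rewrite eval_xyP map_polyC hornerC. Qed.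

Lemma eval_xyY : eval_xy C 'X = y.
Proof. by rewrite /eval_xy map_polyX bievalX. Qed.

Lemma eval_xyX : eval_xy C 'X%:P = x.
Proof. by rewrite eval_xyP map_polyX hornerX. Qed.

Lemma eval_cubic : eval_xy C cubic%:P = y ^+ 2.
Proof.
rewrite eval_xyP ec_equation /cubic !rmorphB /= !map_polyZ map_polyC map_polyXn map_polyX.
by rewrite !hornerE rmorph_nat.
Qed.

Lemma reduce_mod_curve p : exists q r0 r1,
  p = q * ('X^2 - cubic%:P) + r0%:P + r1%:P * 'X.
Proof.
elim/poly_ind: p => [|p c [q [r0 [r1 ->]]]].
  by exists 0, 0, 0; rewrite mul0r !polyC0 mul0r !addr0.
(* One Horner step: [r1 * 'X^2] is [r1 * cubic] plus a multiple of the equation of the curve. *)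
exists (q * 'X + r1%:P), (c + r1 * cubic), r0.
rewrite [(c + _)%:P]polyCD [(_ * _)%:P]polyCM.
by move: cubic%:P r0%:P r1%:P c%:P ('X : {poly {poly K}}) => *; ring.
Qed.

Lemma coord_ringP h : coord_ring h <->
  exists r0 r1, h = (map_poly iota r0).[x] + (map_poly iota r1).[x] * y.
Proof.
split=> [[p ->]|[r0 [r1 ->]]]; last first.
  by exists (r0%:P + r1%:P * 'X); rewrite eval_xyD eval_xyM eval_xyY !eval_xyP.
have [q [r0 [r1 ->]]] := reduce_mod_curve p; exists r0, r1.
rewrite !eval_xyD eval_xyM eval_xyB !eval_xyM eval_xyY !eval_xyP -eval_xyP eval_cubic.
by rewrite -eval_xyP; ring.
Qed.

End CoordinateRing.

Section PoleOrders.
Variables (K : fieldType) (C : weierstrass_curve K).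
Hypothesis (K0 : [pchar K] =i pred0).
Local Notation L := (ec_L C).
Local Notation iota := (@ec_iota K C).
Local Notation x := (ec_x C).
Local Notation y := (ec_y C).
Local Notation laurent := (@ec_laurent K C).
Implicit Types (p q : {poly {poly K}}) (r : {poly K}) (h k : L).

Let natK (n : nat) : (n%:R == 0 :> K) = (n == 0%N).
Proof. by move/pcharf0P: K0 => ->. Qed.

Lemma ord_x : ord_ge x (-2) /\ laurent x (-2) = 1.
Proof.
split=> [i|]; rewrite ec_laurent_x //=.
by case: i => [|[|[|i]]] //; lia.
Qed.

(** As [dx = y alpha], the function [y] is the z-derivative of [x]. Dividing by [y] is legitimate:
    if [y] were 0, [x] would be a root of the cubic, whose leading coefficient is 4. *)
Lemma laurent_y i : laurent y i = (i + 1)%:~R * laurent x (i + 1).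
Proof.
have [y0|y0] := eqVneq y 0.
  have /eqP/esym/eqP := ec_equation C; rewrite y0 expr0n /= => e.
  suff /eqP : cubic C = 0.
    rewrite /cubic => /eqP/(congr1 (fun r => r`_3))/eqP.
    rewrite !coefB !coefZ coefXn poly.coefX coefC coef0 /= !subr0 mulr1 mulr0.
    by rewrite subr0 (natK 4).
  apply: (@ec_transcendental K C); rewrite /root -eval_xyP eval_cubic.
  by rewrite y0 expr0n.
apply: (congr1 (@^~ i) (ec_laurent_d _)).
by rewrite scalerA divff ?scale1r.
Qed.

Lemma ord_y : ord_ge y (-3) /\ laurent y (-3) = -2.
Proof.
have [x1 x2] := ord_x; split=> [i i3|].
  by rewrite laurent_y x1 ?mulr0 //; lia.
by rewrite laurent_y /= x2 mulr1.
Qed.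

Lemma ord_horner_x r : r != 0 ->
  ord_ge (map_poly iota r).[x] (- 2 *+ (size r).-1) /\
  laurent (map_poly iota r).[x] (- 2 *+ (size r).-1) = lead_coef r.
Proof.
move=> r0; have [x1 x2] := ord_x.
have rS : size r = (size r).-1.+1 by rewrite prednK // size_poly_gt0.
rewrite horner_coef size_map_poly rS big_ord_recr /= lead_coefE.
set d := (size r).-1.
have T (i : nat) : ord_ge ((map_poly iota r)`_i * x ^+ i) (- 2 *+ i) /\
    laurent ((map_poly iota r)`_i * x ^+ i) (- 2 *+ i) = r`_i.
  have [X1 X2] := laurent_exp_lead i x1.
  by rewrite coef_map laurent_constM X2 x2 expr1n mulr1; split => //; exact: ord_ge_constM.
have S : ord_ge (\sum_(i < d) (map_poly iota r)`_i * x ^+ i) (- 2 *+ d + 1).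
  apply: ord_ge_sum => i _; have [+ _] := T i; move/ord_ge_le; apply.
  by have := ltn_ord i; lia.
have [T1 T2] := T d; split.
  by apply: ord_ge_add => //; apply: (ord_ge_le S); lia.
by rewrite ec_laurent_add S ?add0r //; lia.
Qed.

(* r0(x) has even order and r1(x) y odd order at infinity, so they cannot cancel. *)
Lemma no_simple_pole r0 r1 :
  ord_ge ((map_poly iota r0).[x] + (map_poly iota r1).[x] * y) (-1) ->
  r1 = 0 /\ r0 = (r0`_0)%:P.
Proof.
move=> H; have [y1 y2] := ord_y.
have ry : r1 != 0 -> ord_ge ((map_poly iota r1).[x] * y) (- 2 *+ (size r1).-1 - 3) /\
    laurent ((map_poly iota r1).[x] * y) (- 2 *+ (size r1).-1 - 3) != 0.
  move=> r10; have [A B] := ord_horner_x r10.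
  split; first exact: ord_ge_mul.
  rewrite laurent_mul_lead // B y2 mulf_neq0 ?lead_coef_eq0 //.
  by rewrite oppr_eq0 (natK 2).
have [r10|r10] := eqVneq r1 0; last first.
  have [A B] := ry r10; exfalso.
  have [r00|r00] := eqVneq r0 0.
    move: H; rewrite r00 rmorph0 horner0 add0r => H.
    by rewrite H ?eqxx // in B; lia.
  have [A' B'] := ord_horner_x r00.
  have [lt|lt] := leqP (size r0).-1 (size r1).-1.+1.
    have := H (- 2 *+ (size r1).-1 - 3); rewrite ec_laurent_add A'; last lia.
    by rewrite add0r => e; move: B; rewrite e ?eqxx //; lia.
  have := H (- 2 *+ (size r0).-1); rewrite ec_laurent_add B' A; last lia.
  rewrite addr0 => e; have : lead_coef r0 == 0 by rewrite e //; lia.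
  by rewrite lead_coef_eq0 (negbTE r00).
split=> //; apply: size1_polyC; rewrite leqNgt; apply/negP => s1.
have r00 : r0 != 0 by rewrite -size_poly_gt0; lia.
have [A' B'] := ord_horner_x r00.
have := H (- 2 *+ (size r0).-1); rewrite r10 rmorph0 horner0 mul0r addr0 B' => e.
have : lead_coef r0 == 0 by rewrite e //; lia.
by rewrite lead_coef_eq0 (negbTE r00).
Qed.

Lemma coord_ring_const h : coord_ring h -> ord_ge h (-1) -> exists c, h = iota c.
Proof.
move=> /coord_ringP[r0 [r1 ->]] /no_simple_pole[-> ->]; exists r0`_0.
by rewrite rmorph0 horner0 mul0r addr0 map_polyC hornerC.
Qed.

(** Makes values at points of the curve well defined. Modulo the equation, [p] becomes
    [r0 + r1 * 'X]; this evaluates to 0, so it has no pole, and [no_simple_pole] leaves only a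
    constant. *)
Lemma eval_xy_eq0 p b1 b2 : on_curve C b1 b2 -> eval_xy C p = 0 -> bieval p b1 b2 = 0.
Proof.
move=> b12; have [q [r0 [r1 ->]]] := reduce_mod_curve C p.
have bc : b2 ^+ 2 = (cubic C).[b1] by rewrite b12 /cubic !hornerE.
have cub : eval_xy C ('X^2 - (cubic C)%:P) = 0.
  by rewrite eval_xyB eval_cubic expr2 eval_xyM eval_xyY subrr.
rewrite eval_xyD eval_xyD eval_xyM cub mulr0 add0r eval_xyM eval_xyY !eval_xyP => e.
have [|r10 r0C] := @no_simple_pole r0 r1; first by rewrite e; exact: ord_ge0.
move: e; rewrite r10 rmorph0 horner0 mul0r addr0 r0C map_polyC hornerC => /eqP.
rewrite fmorph_eq0 => /eqP ->.
rewrite !bievalD !bievalM bievalB !bievalC expr2 bievalM bievalX -expr2 bc subrr.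
by rewrite !hornerC mulr0 mul0r !addr0.
Qed.

Lemma value_at_scale b1 b2 c h a a' : on_curve C b1 b2 ->
  value_at b1 b2 (iota c * h) a -> value_at b1 b2 h a' -> a = c * a'.
Proof.
move=> b12 [p [q [q0 e ->]]] [p' [q' [q'0 e' ->]]].
have nz s : bieval s b1 b2 != 0 -> eval_xy C s != 0.
  by apply: contraNneq => /(eval_xy_eq0 b12) ->.
have := @eval_xy_eq0 (c%:P%:P * p' * q - p * q') b1 b2 b12.
rewrite eval_xyB !eval_xyM eval_xyC bievalB !bievalM bievalC hornerC.
move: e; rewrite e' => /eqP; rewrite mulrA eqr_div ?nz // => /eqP -> /(_ (subrr _))/eqP.
by rewrite subr_eq0 mulrA => e2; apply/esym/eqP; rewrite eqr_div.
Qed.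

End PoleOrders.

(** * Stalks, sections and differentials *)

Section Span.
Variables (R0 : nzRingType) (V : lmodType R0) (R : set R0) (G : set V).
Local Notation span := (Defs.span (V := V)).

Lemma span_gen g : R 1 -> G g -> span R G g.
Proof.
move=> R1 Gg; exists 1%N, (fun=> 1), (fun=> g).
by split=> //; rewrite big_ord1 scale1r.
Qed.

Lemma span0 : span R G 0.
Proof. by exists 0%N, (fun=> 0), (fun=> 0); split=> [[]|[]|]; rewrite ?big_ord0. Qed.

Lemma span_add u u' : span R G u -> span R G u' -> span R G (u + u').
Proof.
move=> [m [c [g [Rc Gg ->]]]] [m' [c' [g' [Rc' Gg' ->]]]].
exists (m + m')%N, (fun i => match fintype.split i with inl j => c j | inr j => c' j end),
  (fun i => match fintype.split i with inl j => g j | inr j => g' j end).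
split=> [i|i|]; try by case: fintype.split.
rewrite big_split_ord /=; congr (_ + _); apply: eq_bigr => i _.
  by rewrite (unsplitK (inl i)).
by rewrite (unsplitK (inr i)).
Qed.

Lemma span_scale a u : (forall c, R c -> R (a * c)) -> span R G u -> span R G (a *: u).
Proof.
move=> Ra [m [c [g [Rc Gg ->]]]]; exists m, (fun i => a * c i), g; split=> //.
  by move=> i; exact: Ra.
by rewrite scaler_sumr; apply: eq_bigr => i _; rewrite scalerA.
Qed.

Lemma span_sum (I : eqType) (r : seq I) (F : I -> V) :
  (forall i, i \in r -> span R G (F i)) -> span R G (\sum_(i <- r) F i).
Proof.
move=> H; rewrite big_seq; elim/big_ind: _ => //; [exact: span0|exact: span_add].
Qed.

Lemma span_min (S : set V) : S 0 -> (forall u u', S u -> S u' -> S (u + u')) ->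
  (forall c g, R c -> G g -> S (c *: g)) -> span R G `<=` S.
Proof.
by move=> S0 SD SZ _ [m [c [g [Rc Gg ->]]]]; elim/big_ind: _ => // i _; exact: SZ.
Qed.

End Span.

Section Stalks.
Variables (K : fieldType) (C : weierstrass_curve K).
Local Notation L := (ec_L C).
Local Notation Omega := (ec_Omega C).
Local Notation iota := (@ec_iota K C).
Local Notation x := (ec_x C).
Local Notation y := (ec_y C).
Local Notation coord_ring := (@coord_ring K C).
Implicit Types (h k : L) (U : set (point C)) (om : Omega).

(** Shared by the coordinate ring, the stalks and all rings of sections, so that regularity of the
    coefficients of exponentials and gauges is proved once. *)
Record is_subalgebra (R : set L) : Prop := IsSubalgebra {
  subalg_const : forall c, R (iota c);
  subalg_add : forall h k, R h -> R k -> R (h + k);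
  subalg_mul : forall h k, R h -> R k -> R (h * k) }.

Section SubalgebraTheory.
Variables (R : set L) (RR : is_subalgebra R).

Lemma subalg0 : R 0. Proof. by rewrite -(rmorph0 iota); exact: subalg_const. Qed.
Lemma subalg1 : R 1. Proof. by rewrite -(rmorph1 iota); exact: subalg_const. Qed.
Lemma subalg_nat n : R n%:R.
Proof. by rewrite -(rmorph_nat iota); exact: subalg_const. Qed.
Lemma subalg_natV n : R (n%:R)^-1.
Proof. by rewrite -(rmorph_nat iota) -fmorphV; exact: subalg_const. Qed.
Lemma subalg_opp h : R h -> R (- h).
Proof.
by move=> Rh; rewrite -mulN1r -(rmorphN1 iota); apply: subalg_mul => //; exact: subalg_const.
Qed.
Lemma subalg_sub h k : R h -> R k -> R (h - k).
Proof. by move=> Rh Rk; apply: subalg_add => //; exact: subalg_opp. Qed.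
Lemma subalg_exp h n : R h -> R (h ^+ n).
Proof.
by move=> Rh; elim: n => [|n IH]; [exact: subalg1|rewrite exprS; exact: subalg_mul].
Qed.
Lemma subalg_sum (I : Type) (r : seq I) (p : pred I) (F : I -> L) :
  (forall i, p i -> R (F i)) -> R (\sum_(i <- r | p i) F i).
Proof.
by move=> H; elim/big_ind: _ => //; [exact: subalg0|move=> *; exact: subalg_add].
Qed.

End SubalgebraTheory.

Lemma coord_ring_subalgebra : is_subalgebra coord_ring.
Proof.
split=> [c|_ _ [p ->] [q ->]|_ _ [p ->] [q ->]].
- by exists c%:P%:P; rewrite eval_xyC.
- by exists (p + q); rewrite eval_xyD.
- by exists (p * q); rewrite eval_xyM.
Qed.

Lemma coord_ring_x : coord_ring x. Proof. by exists 'X%:P; rewrite eval_xyX. Qed.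
Lemma coord_ring_y : coord_ring y. Proof. by exists 'X; rewrite eval_xyY. Qed.

Lemma maximal_prime (m : set L) h k : is_maximal_ideal m ->
  coord_ring h -> coord_ring k -> ~ m h -> ~ m k -> ~ m (h * k).
Proof.
move=> mP Ch Ck mh mk mhk; have [a Ca ma] := max_max mP Ch mh; apply: mk.
(* [a] is an inverse of [h] modulo [m]. *)
have -> : k = a * (h * k) + k * (1 - h * a) by ring.
by apply: (max_add mP); apply: (max_mul mP).
Qed.

Lemma stalk_subalgebra (Q : point C) : is_subalgebra (stalk Q).
Proof.
have CR := coord_ring_subalgebra.
case: Q => [m|] /=; last first.
  split=> [c|h k|h k]; [exact: ord_ge_const|exact: ord_ge_add|].
  by move=> H H'; rewrite -(addr0 0); exact: ord_ge_mul.
have mP := point_idealP m.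
have nz s : ~ point_ideal m s -> s != 0.
  by move=> ms; apply: contra_notN ms => /eqP ->; exact: max_0.
split=> [c|_ _ [a [s [Ca Cs ms ->]]] [b [t [Cb Ct mt ->]]]
          |_ _ [a [s [Ca Cs ms ->]]] [b [t [Cb Ct mt ->]]]].
- exists (iota c), 1; split; [exact: subalg_const|exact: subalg1|exact: max_proper|].
  by rewrite divr1.
- exists (a * t + b * s), (s * t); split.
  + by apply: (subalg_add CR); apply: (subalg_mul CR).
  + exact: (subalg_mul CR).
  + exact: maximal_prime.
  + by rewrite addf_div ?nz.
- exists (a * b), (s * t); split; [exact: (subalg_mul CR)|exact: (subalg_mul CR)| |].
  + exact: maximal_prime.
  + by rewrite mulf_div.
Qed.

Lemma sections_subalgebra U : is_subalgebra (sections U).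
Proof.
split=> [c Q _|h k Hh Hk Q UQ|h k Hh Hk Q UQ].
- by apply: subalg_const; exact: stalk_subalgebra.
- by apply: subalg_add; [exact: stalk_subalgebra|exact: Hh|exact: Hk].
- by apply: subalg_mul; [exact: stalk_subalgebra|exact: Hh|exact: Hk].
Qed.

Lemma sections_opX h : coord_ring h -> sections (@opX K C) h.
Proof.
move=> Ch [m|] //= _; exists h, 1; rewrite divr1; split=> //.
  exact: subalg1 coord_ring_subalgebra.
exact: (max_proper (point_idealP m)).
Qed.

Record is_proper_ideal (I : set L) : Prop := IsProperIdeal {
  ideal_sub : I `<=` coord_ring;
  ideal_0 : I 0;
  ideal_add : forall h k, I h -> I k -> I (h + k);
  ideal_mul : forall h k, coord_ring h -> I k -> I (h * k);
  ideal_proper : ~ I 1 }.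

Lemma exists_maximal_ideal (I : set L) : is_proper_ideal I ->
  exists2 m, is_maximal_ideal m & I `<=` m.
Proof.
move=> IP; have CR := coord_ring_subalgebra.
(* Zorn runs over the sets [A] for which [A] together with [I] is a proper ideal; the union of the
   empty chain is then admissible, standing for [I] itself. *)
have [F FP Ftot|A [AP Amax]] := @Zorn_bigcup L (fun A => is_proper_ideal (A `|` I)).
  split.
  - move=> h [[A FA Ah]|]; last exact: ideal_sub.
    by apply: (ideal_sub (FP A FA)); left.
  - by right; exact: ideal_0.
  - have key A B h k : F A -> F B -> (A `|` I) h -> (B `|` I) k ->
        (\bigcup_(X in F) X `|` I) (h + k).
      move=> FA FB Ah Bk; have [AB|BA] := Ftot A B FA FB.
        have [] := ideal_add (FP B FB) (_ : (B `|` I) h) Bk; last by right.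
          by case: Ah => [/AB|]; [left|right].
        by move=> ?; left; exists B.
      have [] := ideal_add (FP A FA) Ah (_ : (A `|` I) k); last by right.
        by case: Bk => [/BA|]; [left|right].
      by move=> ?; left; exists A.
    move=> h k [[A FA Ah]|Ih] [[B FB Bk]|Ik].
    + by apply: (key A B) => //; left.
    + by apply: (key A A) => //; [left|right].
    + by apply: (key B B) => //; [right|left].
    + by right; exact: ideal_add.
  - move=> h k Ch [[A FA Ak]|Ik]; last by right; exact: ideal_mul.
    have [] := ideal_mul (FP A FA) Ch (_ : (A `|` I) k); first by left.
      by move=> ?; left; exists A.
    by right.
  - by move=> [[A FA A1]|/ideal_proper//]; apply: (ideal_proper (FP A FA)); left.
exists (A `|` I); last by move=> h; right.
split; [exact: ideal_sub|exact: ideal_0|exact: ideal_add|exact: ideal_mul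
       |exact: ideal_proper|].
move=> h Ch mh.
pose J : set L := [set u | exists a k, [/\ (A `|` I) a, coord_ring k & u = a + h * k]].
have mJ : A `|` I `<=` J.
  move=> a ma; exists a, 0; split=> //; first exact: subalg0.
  by rewrite mulr0 addr0.
have JI : J `|` I = J.
  by apply/seteqP; split=> [u [//|Iu]|u]; [apply: mJ; right|left].
have [[a [k [ma Ck e]]]|J1] := pselect (J 1).
  by exists k => //; rewrite e addrK.
exfalso; apply: (Amax J).
  split; first by move=> a Aa; apply: mJ; left.
  move=> /(_ h) JA; apply: mh; left; apply: JA.
  by exists 0, 1; rewrite add0r mulr1; split=> //; [exact: ideal_0|exact: subalg1].
rewrite JI; split=> //.
- move=> _ [a [k [ma Ck ->]]]; apply: (subalg_add CR); first exact: (ideal_sub AP).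
  exact: (subalg_mul CR).
- by apply: mJ; exact: ideal_0.
- move=> _ _ [a [k [ma Ck ->]]] [a' [k' [ma' Ck' ->]]]; exists (a + a'), (k + k').
  by split; [exact: ideal_add|exact: (subalg_add CR)|ring].
- move=> l _ Cl [a [k [ma Ck ->]]]; exists (l * a), (l * k).
  by split; [exact: ideal_mul|exact: (subalg_mul CR)|ring].
Qed.

(** If the ideal of denominators of [h] were proper, it would lie in some maximal ideal [m], but
    regularity at the point [m] provides a denominator outside [m]. *)
Lemma sections_opXP h : sections (@opX K C) h -> coord_ring h.
Proof.
have CR := coord_ring_subalgebra => Hh; apply: contrapT => nh.
pose I : set L := [set s | coord_ring s /\ coord_ring (s * h)].
have [|m mP Im] := @exists_maximal_ideal I.
  split=> [s []//||s t [Cs Csh] [Ct Cth]|s t Cs [Ct Cth]|[_]].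
  - by split; rewrite ?mul0r; exact: subalg0.
  - by split; rewrite ?mulrDl; exact: (subalg_add CR).
  - by split; rewrite -?mulrA; exact: (subalg_mul CR).
  - by rewrite mul1r.
have [//|a [s [Ca Cs ms e]]] := Hh (Some (AffinePoint mP)).
apply: (ms); apply: Im; split=> //; rewrite e mulrCA divff ?mulr1 //.
by apply: contra_notN ms => /eqP ->; exact: (max_0 mP).
Qed.

End Stalks.

(** * Regular and logarithmic differentials *)

Section Differentials.
Variables (K : fieldType) (C : weierstrass_curve K).
Hypothesis (K0 : [pchar K] =i pred0).
Local Notation L := (ec_L C).
Local Notation Omega := (ec_Omega C).
Local Notation iota := (@ec_iota K C).
Local Notation x := (ec_x C).
Local Notation y := (ec_y C).
Local Notation d := (@ec_d K C).
Local Notation laurent := (@ec_laurent K C).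
Local Notation alpha := (alpha C).
Implicit Types (h k : L) (U : set (point C)) (om : Omega).

Let natK (n : nat) : (n%:R == 0 :> K) = (n == 0%N).
Proof. by move/pcharf0P: K0 => ->. Qed.

Let natL (n : nat) : (n%:R == 0 :> L) = (n == 0%N).
Proof. by rewrite -(rmorph_nat iota) fmorph_eq0 natK. Qed.

Lemma ec_d0 : d 0 = 0.
Proof. by rewrite -(rmorph0 iota) ec_d_const. Qed.

Lemma ec_d1 : d 1 = 0.
Proof. by rewrite -(rmorph1 iota) ec_d_const. Qed.

Lemma ec_dN h : d (- h) = - d h.
Proof. by apply/eqP; rewrite -addr_eq0 -ec_d_add addNr ec_d0. Qed.

Lemma y_neq0 : y != 0.
Proof.
have [Y1 Y2] := ord_y C K0; apply: (@laurent_coef_neq0 _ _ _ (-3)).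
by rewrite Y2 oppr_eq0 (natK 2).
Qed.

Lemma alpha_neq0 : alpha != 0.
Proof. by rewrite scaler_eq0 invr_eq0 negb_or y_neq0 ec_dx_neq0. Qed.

Lemma kaehler_stalk_d (Q : point C) h : stalk Q h -> kaehler_stalk Q (d h).
Proof. by move=> Qh; apply: span_gen; [exact: subalg1 (stalk_subalgebra Q)|exists h]. Qed.

Lemma kaehler_stalk_scale (Q : point C) h om :
  stalk Q h -> kaehler_stalk Q om -> kaehler_stalk Q (h *: om).
Proof.
by move=> Qh; apply: span_scale => c Qc; exact: (subalg_mul (stalk_subalgebra Q)).
Qed.

Lemma kaehler_stalk_log (Q : point C) om : kaehler_stalk Q om -> log_stalk Q om.
Proof.
case: Q => [//|] H t Ht; apply: kaehler_stalk_scale => //= i i0; apply: Ht; lia.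
Qed.

Lemma log_stalk0 (Q : point C) : log_stalk Q 0.
Proof. by apply: kaehler_stalk_log; exact: span0. Qed.

Lemma log_stalk_add (Q : point C) om om' :
  log_stalk Q om -> log_stalk Q om' -> log_stalk Q (om + om').
Proof.
case: Q => [Q|] /=; first exact: span_add.
by move=> H H' t Ht; rewrite scalerDr; apply: span_add; [exact: H|exact: H'].
Qed.

Lemma log_stalk_scale (Q : point C) h om :
  stalk Q h -> log_stalk Q om -> log_stalk Q (h *: om).
Proof.
case: Q => [Q|] Hh H; first exact: (@kaehler_stalk_scale (Some Q)).
by move=> t Ht; rewrite scalerA mulrC -scalerA; apply: kaehler_stalk_scale; last exact: H.
Qed.

Lemma log_sections0 U : log_sections U 0.
Proof. by move=> Q _; exact: log_stalk0. Qed.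

Lemma log_sections_add U om om' :
  log_sections U om -> log_sections U om' -> log_sections U (om + om').
Proof. by move=> H H' Q UQ; apply: log_stalk_add; [exact: H|exact: H']. Qed.

Lemma log_sections_scale U h om :
  sections U h -> log_sections U om -> log_sections U (h *: om).
Proof. by move=> H H' Q UQ; apply: log_stalk_scale; [exact: H|exact: H']. Qed.

Lemma log_sections_d U h : sections U h -> log_sections U (d h).
Proof. by move=> H Q UQ; apply/kaehler_stalk_log/kaehler_stalk_d/H. Qed.

Lemma ec_d_equation :
  (2 * y) *: d y = (12 * x ^+ 2 - iota (60 * ec_e C 4)) *: d x.
Proof.
have dn n h : d (n%:R * h) = n%:R *: d h.
  by rewrite -(rmorph_nat iota) ec_d_mul ec_d_const scaler0 addr0.
have dc c h : d (iota c * h) = iota c *: d h.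
  by rewrite ec_d_mul ec_d_const scaler0 addr0.
have := congr1 d (ec_equation C).
rewrite -addrA -opprD !ec_d_add ec_dN !ec_d_add dn dc ec_d_const !exprS !expr0 !mulr1 !ec_d_mul.
rewrite -!scalerDl !scalerA -?scalerDl addr0 -?scaleNr -?scalerDl => e.
have -> : 2 * y = y + y by ring.
by rewrite e scalerA -scalerDl; congr (_ *: _); ring.
Qed.

(* With p = 4 x^3 - g2 x - g3, the discriminant is a combination of p and p',
   while p alpha = y dx and p' alpha = 2 dy. *)
Lemma alpha_regular (Q : affine_point C) : kaehler_stalk (Some Q) alpha.
Proof.
have SR := stalk_subalgebra (Some Q).
set g2 := 60 * ec_e C 4; set g3 := 140 * ec_e C 6.
have Sx : stalk (Some Q) x by apply: sections_opX => //; exact: coord_ring_x.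
have Sy : stalk (Some Q) y by apply: sections_opX => //; exact: coord_ring_y.
have Sc c : stalk (Some Q) (iota c) by exact: (subalg_const SR).
have Sn n : stalk (Some Q) n%:R by exact: (subalg_nat SR).
pose w := 2 * iota g2 * x - 3 * iota g3.
have Sw : stalk (Some Q) w.
  by apply: (subalg_sub SR); rewrite ?mulrA; repeat apply: (subalg_mul SR).
pose D := g2 ^+ 3 - 27 * g3 ^+ 2.
have D0 : iota D != 0 by rewrite fmorph_eq0; exact: ec_nonsingular.
have pa : y ^+ 2 *: alpha = y *: d x.
  by rewrite scalerA expr2 -mulrA divff ?y_neq0 // mulr1.
have pa' : (12 * x ^+ 2 - iota g2) *: alpha = 2 *: d y.
  rewrite scalerA mulrC -scalerA -ec_d_equation scalerA.
  by rewrite mulrCA mulVf ?y_neq0 // mulr1.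
have DE : iota D = (- 9 * w) * y ^+ 2
    + (3 * x * w - iota g2 ^+ 2) * (12 * x ^+ 2 - iota g2).
  rewrite ec_equation -/g2 -/g3 /D /w !(rmorphB, rmorphM, rmorphXn, rmorph_nat) /=.
  by ring.
have -> : alpha = (iota D)^-1 *: ((- 9 * w) *: (y *: d x)
    + (3 * x * w - iota g2 ^+ 2) *: (2 *: d y)).
  rewrite -pa -pa' 2![in RHS]scalerA -[in RHS]scalerDl -DE scalerA mulVf //.
  by rewrite scale1r.
have KS := @kaehler_stalk_scale (Some Q).
rewrite -fmorphV; apply: (KS) => //; apply: span_add.
  apply: (KS); last by apply: (KS) => //; exact: kaehler_stalk_d.
  by apply: (subalg_mul SR) => //; exact: (subalg_opp SR).
apply: (KS); last by apply: (KS) => //; exact: kaehler_stalk_d.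
by apply: (subalg_sub SR); rewrite ?expr2; repeat apply: (subalg_mul SR).
Qed.

(** For a uniformizer [s] at infinity, [ds = k alpha] where [k], the z-derivative of [s], is a unit
    there. Hence [alpha] is regular, and a function vanishing at infinity absorbs the simple pole of
    [h]. *)
Lemma alpha_log s h : ord_ge s 1 -> laurent s 1 != 0 -> ord_ge h (-1) ->
  log_stalk None (h *: alpha).
Proof.
move=> s1 s10 h1 t t1; rewrite scalerA.
have [g] := ec_dx_span (d s).
have [k ->] : exists k, g = k * y^-1 by exists (g * y); rewrite mulfK ?y_neq0.
rewrite -[(k / y) *: _]scalerA -/alpha => e; have Lk := ec_laurent_d e.
have k0 : ord_ge k 0 by move=> i i0; rewrite Lk /laurent_deriv s1 ?mulr0 //; lia.
have k00 : laurent k 0 != 0 by rewrite Lk /laurent_deriv mul1r.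
have -> : alpha = k^-1 *: d s.
  by rewrite e scalerA mulVf ?scale1r //; exact: laurent_coef_neq0 k00.
apply: (@kaehler_stalk_scale None) => /=.
  have t1' : ord_ge t 1 by move=> i i1; apply: t1; lia.
  exact: (ord_ge_mul t1' h1).
apply: (@kaehler_stalk_scale None) => /=.
  by have [+ _] := laurent_inv k0 k00; rewrite oppr0.
apply: kaehler_stalk_d => i i0; apply: s1; lia.
Qed.

End Differentials.

(** * The exponential at infinity *)

Section ExpCoefficients.
Variable R : comNzRingType.

(* If E' = (R + t / (1 + t T)) E as power series in T, then H = E / (1 + t T)
   satisfies H' = R H. *)
Lemma factor_recursion (t : R) (e r h : nat -> R) M :
  (forall k, (k < M)%N ->
    k.+1%:R * e k.+1 = \sum_(i < k.+1) (r i.+1 + t * (- t) ^+ i) * e (k - i)%N) ->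
  h 0%N = e 0%N -> (forall k, h k.+1 = e k.+1 - t * h k) ->
  forall k, (k < M)%N -> k.+1%:R * h k.+1 = \sum_(i < k.+1) r i.+1 * h (k - i)%N.
Proof.
move=> eS h0 hS; elim=> [|k IH] kM.
  by have := eS _ kM; rewrite !big_ord1 !hS h0 /= expr0 mulr1 !mul1r => ->; ring.
have eh j : e j.+1 = h j.+1 + t * h j by rewrite hS subrK.
pose S j := \sum_(i < j.+1) r i.+1 * h (j - i)%N.
pose G j := \sum_(i < j.+1) (- t) ^+ i * h (j - i)%N.
have E1 : \sum_(i < k.+2) (r i.+1 + t * (- t) ^+ i) * e (k.+1 - i)%N
        = S k.+1 + t * G k.+1 + t * (S k + t * G k).
  rewrite big_ord_recr /= subnn -h0 /S /G !(big_ord_recr k.+1) /= subnn.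
  rewrite !mulrDr !mulr_sumr -addrA.
  transitivity (\sum_(i < k.+1) ((r i.+1 * h (k.+1 - i)%N
      + t * ((- t) ^+ i * h (k.+1 - i)%N)) + (t * (r i.+1 * h (k - i)%N)
      + t * (t * ((- t) ^+ i * h (k - i)%N)))) +
      (r k.+2 + t * (- t) ^+ k.+1) * h 0%N).
    congr (_ + _); apply: eq_bigr => i _; have ik := ltn_ord i.
    by rewrite subSn 1?eh; [ring|lia].
  by rewrite !big_split /=; ring.
have E2 : G k.+1 = h k.+1 - t * G k.
  rewrite /G big_ord_recl /= expr0 mul1r subn0 mulr_sumr -sumrN; congr (_ + _).
  by apply: eq_bigr => i _; rewrite /bump /= add1n subSS exprS; ring.
rewrite hS mulrBr eS // E1 E2; have := IH (ltnW kM); rewrite -/(S k) => <-.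
by rewrite -/(S k.+1); ring.
Qed.

End ExpCoefficients.

Section TruncatedExp.
Variable F : fieldType.
Hypothesis F0 : [pchar F] =i pred0.
Implicit Types c : nat -> F.

Definition gen_poly c n : {poly F} := \sum_(1 <= k < n.+1) c k *: 'X^k.

(** The variable stands for T = ad_B. The exponent has no constant term, so its m-th power starts in
    degree m, and cutting both sums at [n] leaves the coefficients up to degree [n] exact. *)
Definition exp_poly c n : {poly F} := \sum_(m < n.+1) m`!%:R^-1 *: gen_poly c n ^+ m.

Lemma coef_gen_poly c n k : (gen_poly c n)`_k = if (0 < k <= n)%N then c k else 0.
Proof.
rewrite /gen_poly coef_sum; case: ifP => [k0|k0].
  rewrite (bigD1_seq k) ?mem_index_iota ?iota_uniq //=.
  rewrite coefZ coefXn eqxx mulr1 big1 ?addr0 // => j jk.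
  by rewrite coefZ coefXn eq_sym (negbTE jk) mulr0.
rewrite big1_seq // => j /=; rewrite mem_index_iota => jn.
rewrite coefZ coefXn; case: eqP => [kj|]; last by rewrite mulr0.
by move: k0; rewrite kj; lia.
Qed.

Lemma coef_gen_polyX c n m k : (k < m)%N -> (gen_poly c n ^+ m)`_k = 0.
Proof.
elim: m k => // m IH k km; rewrite exprS coefM big1 // => i _.
have [i0|i0] := posnP i; first by rewrite coef_gen_poly i0 mul0r.
by rewrite IH ?mulr0 //; have := ltn_ord i; lia.
Qed.

Lemma exp_poly0 c n : (exp_poly c n)`_0 = 1.
Proof.
rewrite /exp_poly coef_sum big_ord_recl /= expr0 coefZ coef1 fact0 invr1 mulr1.
by rewrite big1 ?addr0 // => i _; rewrite coefZ coef_gen_polyX ?mulr0.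
Qed.

(** The equation [E' = g' E] for [E = exp g], read coefficientwise. Differentiating the truncated
    sum loses the power [g^n], which has no coefficient below degree [n]. *)
Lemma exp_poly_rec c n k : (k.+1 < n)%N ->
  k.+1%:R * (exp_poly c n)`_k.+1
  = \sum_(i < k.+1) i.+1%:R * c i.+1 * (exp_poly c n)`_(k - i).
Proof.
move=> kn; have natF (m : nat) : (m%:R == 0 :> F) = (m == 0%N).
  by move/pcharf0P: F0 => ->.
have D : (exp_poly c n)^`() =
    (gen_poly c n)^`() * \sum_(m < n) m`!%:R^-1 *: gen_poly c n ^+ m.
  rewrite /exp_poly big_ord_recl /= derivD derivZ expr0 derivC scaler0 add0r.
  rewrite raddf_sum mulr_sumr; apply: eq_bigr => i _ /=.
  rewrite derivZ deriv_exp /bump /= add1n -scalerAr -scaler_nat scalerA factS natrM.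
  by rewrite invfM mulrAC mulVf ?mul1r // natF.
have := congr1 (fun p : {poly F} => p`_k) D; rewrite mulr_natl coef_deriv => ->.
rewrite coefM; apply: eq_bigr => i _; have ik := ltn_ord i.
rewrite coef_deriv coef_gen_poly (_ : (0 < i.+1 <= n)%N); last lia.
rewrite mulr_natl; congr (_ * _).
rewrite /exp_poly big_ord_recr coefD coefZ coef_gen_polyX ?mulr0 ?addr0 //=; lia.
Qed.

End TruncatedExp.

(** * Power series in ad_B applied to A *)

Section AdjointSeries.
Variables (K : fieldType) (C : weierstrass_curve K).
Local Notation L := (ec_L C).
Local Notation ncs := (@series K C L^o).
Implicit Types (u : ncs) (w : word) (c : nat -> L) (p : {poly L}).

Lemma ncmul_serB u w :
  ncmul (serB C) u w = (if take 1 w == [:: false] then 1 else 0) * u (drop 1 w).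
Proof.
rewrite /ncmul /serB /monomial; case: w => [|a w].
  by rewrite big_ord1 /= scale0r mul0r.
rewrite big_ord_recl [X in X + _]/= scale0r add0r /= big_ord_recl /= big1 ?addr0 //.
move=> i _; case: w i => [[]//|b w] i.
by rewrite add0n /bump add1n eqseq_cons andbF scale0r.
Qed.

Lemma ncmul_serB_r u w : ncmul u (serB C) w =
  (if drop (size w).-1 w == [:: false] then 1 else 0) * u (take (size w).-1 w).
Proof.
rewrite /ncmul /serB /monomial; case/lastP: w => [|w a].
  by rewrite big_ord1 /= scaler0 mul0r.
rewrite size_rcons big_ord_recr drop_oversize ?size_rcons //= scaler0 addr0.
rewrite big_ord_recr big1 => [|i _] /=; last first.
  case: eqP => [e|]; last by rewrite scaler0.
  have := congr1 (@size letter) e; rewrite size_drop size_rcons /=; have := ltn_ord i; lia.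
by rewrite add0r mulrC.
Qed.

Lemma ad_BE u w : ad_B u w =
  (if take 1 w == [:: false] then 1 else 0) * u (drop 1 w)
  - (if drop (size w).-1 w == [:: false] then 1 else 0) * u (take (size w).-1 w).
Proof. by rewrite -ncmul_serB -ncmul_serB_r. Qed.

(** [ad_B^k(A)] is homogeneous of degree k + 1, so a word [w] sees only the power k = |w| - 1. *)
Definition ad_word w : L := iter (size w).-1 (@ad_B K C) (serA C) w.

(* On words of length at most n, u = \sum_k p_k ad_B^k(A). *)
Definition represents n p u : Prop :=
  forall w, (size w <= n)%N -> u w = p`_(size w).-1 * ad_word w.

Lemma ad_word0 : ad_word [::] = 0.
Proof. by []. Qed.

Lemma represents_ad_B n p u : represents n p u -> represents n (p * 'X) (ad_B u).
Proof.
move=> pu w wn; rewrite ad_BE coefMX.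
(* The predecessor of the length is 0 for lengths 0 and 1 alike, so these words are treated apart;
   both sides vanish on them. *)
case: w wn => [|a [|b w]] wn.
- by rewrite /= !mul0r subrr.
- by rewrite /= !pu // !ad_word0 !mulr0 subrr mul0r.
rewrite [ad_word _]/ad_word [_.-1]/= iterS ad_BE.
rewrite !pu; try by rewrite ?size_drop ?size_takel /=; move: wn => /=; lia.
rewrite /ad_word size_drop size_takel //=; ring.
Qed.

Lemma represents_iter_ad_B n p u k :
  represents n p u -> represents n (p * 'X^k) (iter k (@ad_B K C) u).
Proof.
move=> pu; elim: k => [|k IH]; first by rewrite mulr1.
by rewrite exprSr mulrA; exact: represents_ad_B.
Qed.

Lemma represents_ad_series n c p u :
  represents n p u -> represents n (p * gen_poly c n) (ad_series c u).
Proof.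
move=> pu w wn; rewrite /ad_series /gen_poly mulr_sumr coef_sum mulr_suml.
rewrite [RHS](big_cat_nat _ (n := (size w).+1)) //= [X in _ + X]big1_seq => [|k].
  rewrite addr0; apply: eq_big_nat => k _.
  by rewrite (represents_iter_ad_B k pu) // -scalerAr coefZ mulrA.
rewrite mem_index_iota /= -scalerAr coefZ coefMXn => /andP[wk _].
by rewrite (_ : ((size w).-1 < k)%N) ?mulr0 ?mul0r //; lia.
Qed.

(** Every series met in the exponential is a polynomial in ad_B applied to A, so the noncommutative
    computation takes place in commutative polynomials in one variable. *)
Lemma exp_adE c w :
  exp_ad c (serA C) w = (exp_poly c (size w))`_(size w).-1 * ad_word w.
Proof.
have rep m : represents (size w) (gen_poly c (size w) ^+ m)
    (iter m (ad_series c) (serA C)).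
  elim: m => [|m IH]; last by rewrite exprSr; exact: represents_ad_series.
  move=> v _; rewrite expr0 coef1 /ad_word /=.
  case: v => [|a [|b v]]; rewrite /= ?mulr0 ?mul1r ?mul0r //.
  by rewrite /serA /monomial eqseq_cons andbF.
rewrite /exp_ad /exp_poly coef_sum mulr_suml; apply: eq_bigr => m _.
by rewrite rep // coefZ mulrA.
Qed.

Lemma ad_word_subalgebra (R : set L) w : is_subalgebra R -> R (ad_word w).
Proof.
move=> RR; rewrite /ad_word; move: (size w).-1 => k.
have R01 (b : bool) : R (if b then 1 else 0).
  by case: b; [exact: subalg1|exact: subalg0].
elim: k w => [|k IH] w; first exact: R01.
by rewrite iterS ad_BE; apply: (subalg_sub RR); apply: (subalg_mul RR).
Qed.

(** ad_B preserves the degree in A. The connection forms thus raise it by at most one, which is what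
    transversality asks of the word filtration. *)
Lemma ad_word_degA w : degA w != 1%N -> ad_word w = 0.
Proof.
rewrite /ad_word; move: (size w).-1 => k; elim: k w => [|k IH] w w1.
  rewrite /= /serA /monomial; case: eqP => // e; by rewrite e in w1.
rewrite iterS ad_BE.
have T1 : take 1 w == [:: false] -> degA (drop 1 w) = degA w.
  move/eqP=> e; have := cat_take_drop 1 w; rewrite e => e'.
  by rewrite -[in RHS]e'.
have T2 : drop (size w).-1 w == [:: false] -> degA (take (size w).-1 w) = degA w.
  move/eqP=> e; have := cat_take_drop (size w).-1 w; rewrite e => e'.
  by rewrite -[in RHS]e' /degA count_cat /= !addn0.
case: ifP => [/T1 e1|_]; case: ifP => [/T2 e2|_];
  rewrite ?mul0r ?mul1r ?IH ?subrr ?e1 ?e2 //.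
Qed.

Lemma exp_ad_subalgebra (R : set L) c w : is_subalgebra R ->
  (forall k, R (c k)) -> R (exp_ad c (serA C) w).
Proof.
move=> RR Rc; rewrite exp_adE; apply: (subalg_mul RR); last exact: ad_word_subalgebra.
have RP (p q : {poly L}) : (forall i, R p`_i) -> (forall i, R q`_i) ->
    forall i, R (p * q)`_i.
  move=> Rp Rq i; rewrite coefM; apply: (subalg_sum RR) => j _.
  exact: (subalg_mul RR).
rewrite /exp_poly coef_sum; apply: (subalg_sum RR) => m _; rewrite coefZ.
apply: (subalg_mul RR); first exact: subalg_natV.
move: (_.-1) => i; move: i; elim: (m : nat) => [|j IH] i.
  by rewrite expr0 coef1; exact: subalg_nat.
rewrite exprS; apply: RP => // k; rewrite coef_gen_poly.
by case: ifP => _ //; exact: subalg0.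
Qed.

Lemma exp_ad_degA c w : degA w != 1%N -> exp_ad c (serA C) w = 0.
Proof. by move=> w1; rewrite exp_adE ad_word_degA ?mulr0. Qed.

Lemma exp_ad_nil c : exp_ad c (serA C) [::] = 0.
Proof. exact: exp_ad_degA. Qed.

Lemma exp_ad_A c : exp_ad c (serA C) [:: true] = 1.
Proof. by rewrite exp_adE exp_poly0 mul1r. Qed.

End AdjointSeries.

(** * Polar parts of the functions P_k and of the exponential *)

Section LocalExpansion.
Variables (K : fieldType) (C : weierstrass_curve K).
Hypothesis (K0 : [pchar K] =i pred0).
Local Notation L := (ec_L C).
Local Notation iota := (@ec_iota K C).
Local Notation laurent := (@ec_laurent K C).
Variables (P : nat -> L) (f : L).
Hypotheses (P_def : is_P P) (f_def : is_f f).

Let natK (n : nat) : (n%:R == 0 :> K) = (n == 0%N).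
Proof. by move/pcharf0P: K0 => ->. Qed.

Let natL (n : nat) : (n%:R == 0 :> L) = (n == 0%N).
Proof. by rewrite -(rmorph_nat iota) fmorph_eq0 natK. Qed.

Lemma iter_laurent_deriv n (a : int -> K) i :
  iter n (@laurent_deriv K) a i = \prod_(l < n) (i + l.+1%:Z)%:~R * a (i + n%:Z).
Proof.
elim: n i => [|n IH] i; first by rewrite big_ord0 mul1r addr0.
rewrite iterS {1}/laurent_deriv IH big_ord_recl mulrA /=; congr (_ * _ * _).
  by apply: eq_bigr => l _; congr (_%:~R); rewrite /bump /=; lia.
by congr a; lia.
Qed.

Lemma prod_succ n : \prod_(l < n) (l.+1%:Z)%:~R = n`!%:R :> K.
Proof.
elim: n => [|n IH]; first by rewrite big_ord0.
by rewrite big_ord_recr IH /= factS natrM mulrC.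
Qed.

(** The factor produced by differentiating [z^-2] n times. *)
Lemma prod_pred n : \prod_(l < n) (- n.+2%:Z + l.+1%:Z)%:~R = (-1) ^+ n * n.+1`!%:R :> K.
Proof.
rewrite (reindex_inj rev_ord_inj) /=.
transitivity (\prod_(l < n) (- 1 * (l.+2%:Z)%:~R) : K).
  apply: eq_bigr => l _; rewrite mulN1r -rmorphN; congr (_%:~R).
  by have := ltn_ord l; lia.
rewrite big_split /= big_const_ord iter_mulr_1.
congr (_ * _); have := prod_succ n.+1; rewrite big_ord_recl mul1r => <-.
by apply: eq_bigr.
Qed.

Lemma iter_deriv_wp n i : i < 1 ->
  (-1) ^+ n / n.+1`!%:R * iter n (@laurent_deriv K) (wp_series (ec_e C)) i
  = if i == - n.+2%:Z then 1 else if i == 0 then ec_e C n.+2 else 0.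
Proof.
have fact0 m : m`!%:R != 0 :> K by rewrite natK -lt0n fact_gt0.
move=> i1; rewrite iter_laurent_deriv; have [->|i2] := eqVneq i (- n.+2%:Z).
  rewrite prod_pred (_ : - n.+2%:Z + n%:Z = Negz 1) /=; last lia.
  by rewrite mulr1 mulrACA -expr2 sqrr_sign mulVf // mul1r.
have [->|i0] := eqVneq i 0.
  rewrite (eq_bigr (fun l : 'I_n => (l.+1%:Z)%:~R)) => [|l _]; last by rewrite add0r.
  (* The conventions [e_2 = 0] and [e_k = 0] for odd k make the constant term [e_(n+2)] uniformly in
     n. *)
  rewrite prod_succ add0r; case: n {i2} => [|m] /=; first by rewrite ec_e2 !mulr0.
  case odd_m: (odd m) => /=; last by rewrite !mulr0 ec_eodd //= odd_m.
  rewrite -signr_odd /= odd_m expr0 mul1r factS natrM.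
  have S0 : m.+2%:R != 0 :> K by rewrite natK.
  move: S0 (fact0 m.+1); move: m.+2%:R m.+1`!%:R => a b a0 b0.
  by field; rewrite a0 b0.
have [ni|ni] := ltP i (- n%:Z).
  rewrite (_ : wp_series _ _ = 0) ?mulr0 //=.
  by case ein: (i + n%:Z) => [m|m] /=; [lia|case: eqP => // em; lia].
(* Here [-n <= i < 0]: the monomial [z^(i+n)] has degree in [0, n), so its n-th derivative is 0,
   visible as a zero factor of the product. *)
have lt : (`|i|.-1 < n)%N by lia.
rewrite (bigD1 (Ordinal lt)) //= (_ : i + `|i|.-1.+1%:Z = 0) ?mul0r ?mulr0 //; lia.
Qed.

Lemma P_expands k : (2 <= k)%N -> expands (P k) (- k%:Z) 1 1.
Proof.
case: k => [|[|n]] // k2 i i1; have [_ ->] := P_def k2.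
rewrite -signr_odd /= negbK signr_odd subn2 iter_deriv_wp // /laurent_const.
have [->|_] := eqVneq i (- n.+2%:Z); first by rewrite subr0.
by case: eqP; rewrite subrr.
Qed.

Lemma ord_f : ord_ge f (-1) /\ laurent f (-1) = -1.
Proof. by case: f_def. Qed.

Lemma uniformizer : ord_ge f^-1 1 /\ laurent f^-1 1 != 0.
Proof.
have [f1 f2] := ord_f; have [|A B] := laurent_inv f1; first by rewrite f2 oppr_eq0 oner_eq0.
by rewrite opprK in A B; rewrite B f2 invr_eq0 oppr_eq0 oner_eq0.
Qed.

Lemma exp_coefY_pole w : ord_ge (exp_ad (coefY P f) (serA C) w) (-1).
Proof.
rewrite exp_adE; set n := size w.
suff E : forall k, (k < n)%N -> ord_ge (exp_poly (coefY P f) n)`_k (-1).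
  rewrite -(addr0 (-1)); apply: ord_ge_mul; last exact: ad_word_subalgebra (stalk_subalgebra None).
  have [n0|n0] := posnP n; last by apply: E; rewrite prednK.
  by rewrite n0 exp_poly0; apply: (ord_ge_le (subalg1 (stalk_subalgebra (@None (affine_point C))))).
have [f1 f2] := ord_f; have [s1 s2] := uniformizer.
(* With this precision [t^k] agrees with [z^-k] up to O(z^(n + 2 - k)), hence past the constant term
   for every k <= n. *)
have [||t Et] := @approx_monomial _ _ _ (- f) (-1) n.+1%:Z s1 s2.
- exact: ord_ge_opp.
- by rewrite laurentN f2 opprK.
pose e k := (exp_poly (coefY P f) n)`_k.
(* k times the k-th coefficient of the exponent minus log(1 + t T); the polar parts and the constant
   terms cancel. *)
pose r k := k%:R * coefY P f k + (- t) ^+ k.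
(* The coefficients of the exponential divided by 1 + t T. By the recursion below they are 1 in
   degree 0 and O(z) afterwards. *)
pose h := fix h k := if k is k'.+1 then e k - t * h k' else e 0%N.
have r_ord k : (0 < k <= n)%N -> ord_ge (r k) 1.
  move=> /andP[k0 kn] i i1; rewrite /r.
  case: k k0 kn => [//|[|k]] _ kn.
    rewrite mul1r expr1 /coefY /= -opprD laurentN ec_laurent_add Et; last lia.
    have [_ _ _ f0] := f_def.
    case: eqP => [->|ni]; first by rewrite f2 addNr oppr0.
    rewrite addr0; have [->|i0] := eqVneq i 0; first by rewrite f0 oppr0.
    by rewrite f1 ?oppr0 //; lia.
  rewrite /coefY /coefX /= mulrN mulrCA divff ?mulr1; last by rewrite natL.
  rewrite [(- t) ^+ _]exprNn [X in laurent X]addrC -mulrBr.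
  rewrite -(rmorphN1 iota) -rmorphXn laurent_constM laurentB.
  have n1 : -1 <= n.+1%:Z :> int by lia.
  rewrite (P_expands _ i1) // (expands_exp (j := k.+2) n1 Et); last lia.
  by rewrite expr1n (_ : -1 *+ k.+2 = - k.+2%:Z :> int) ?subrr ?mulr0 //; lia.
have hP : forall k, (k < n.-1)%N ->
    k.+1%:R * h k.+1 = \sum_(i < k.+1) r i.+1 * h (k - i)%N.
  apply: (@factor_recursion _ t e r h n.-1) => // k kn.
  rewrite /e exp_poly_rec; [|exact/pcharf0P|lia]; apply: eq_bigr => i _; congr (_ * _).
  by rewrite /r exprS; ring.
have h_ord k : (k < n)%N -> ord_ge (h k) (if k == 0%N then 0 else 1).
  elim/ltn_ind: k => -[|k] IH kn.
    by rewrite /= /e exp_poly0; exact: (subalg1 (stalk_subalgebra (@None (affine_point C)))).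
  have k0 : k.+1%:R != 0 :> L by rewrite natL.
  have -> : h k.+1 = iota (k.+1%:R)^-1 * \sum_(i < k.+1) r i.+1 * h (k - i)%N.
    by rewrite -hP; [rewrite mulrA fmorphV rmorph_nat mulVf // mul1r|lia].
  apply: ord_ge_constM; apply: ord_ge_sum => i _.
  have ik := ltn_ord i.
  rewrite -(addr0 1); apply: ord_ge_mul; first by apply: r_ord; lia.
  apply: ord_ge_le (IH (k - i)%N _ _) _; [lia|lia|by case: ifP].
have t1 : ord_ge t (-1) by apply: (expands_ord_ge Et); lia.
case=> [|k] kn.
  rewrite exp_poly0; apply: (ord_ge_le (N := 0)) => //.
  exact: (subalg1 (stalk_subalgebra (@None (affine_point C)))).
(* Multiplying back by 1 + t T costs a single factor [t], hence one pole. *)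
rewrite -/(e k.+1) (_ : e k.+1 = h k.+1 + t * h k); last by rewrite /= subrK.
apply: ord_ge_add; first exact: (ord_ge_le (h_ord _ kn)).
rewrite -(addr0 (-1)); apply: ord_ge_mul => //.
by apply: ord_ge_le (h_ord _ _) _; [lia|case: ifP].
Qed.

End LocalExpansion.

(** * The word filtration *)

Section Words.

Fixpoint words n : seq word :=
  [::] :: if n is n'.+1 then [seq a :: w | a <- [:: true; false], w <- words n'] else [::].

Lemma mem_words n w : (w \in words n) = (size w <= n)%N.
Proof.
elim: n w => [|n IH] w; first by rewrite mem_seq1 leqn0 size_eq0.
rewrite in_cons -/words; case: w => [|a w] //=.
rewrite cats0 mem_cat ltnS -IH.
have M : forall b, (a :: w \in [seq b :: w | w <- words n]) = (a == b) && (w \in words n).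
  move=> b; apply/mapP/andP => [[w' w'n [-> ->]] //|[/eqP -> wn]]; by exists w.
by rewrite !M; case: a {M} => /=; rewrite ?orbF.
Qed.

Lemma uniq_words n : uniq (words n).
Proof.
elim: n => // n IH; rewrite [words _]/= cons_uniq cats0; apply/andP; split.
  by rewrite mem_cat; apply/norP; split; apply/mapP => -[].
rewrite cat_uniq !map_inj_uniq ?IH //=; try by move=> ? ? [].
rewrite andbT; apply/hasPn => _ /mapP[w _ ->]; apply/negP => /mapP[w' _ [//]].
Qed.

(** The list [s] may contain words longer than [n] as long as [F] vanishes there; this covers a
    neighbour such as Bw of a word [w] of full length. *)
Lemma sum_words_supp (V : zmodType) n (F : word -> V) (s : seq word) : uniq s ->
  (forall w, (size w <= n)%N -> w \notin s -> F w = 0) ->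
  (forall w, w \in s -> (n < size w)%N -> F w = 0) ->
  \sum_(w <- words n) F w = \sum_(w <- s) F w.
Proof.
move=> us H1 H2; rewrite (bigID (mem s)) /= [X in _ + X]big1_seq ?addr0; last first.
  by move=> w /andP[ws]; rewrite mem_words => wn; exact: H1.
rewrite [RHS](bigID (mem (words n))) /= [X in _ = _ + X]big1_seq ?addr0; last first.
  by move=> w /andP[]; rewrite mem_words -ltnNge => wn ws; exact: H2.
rewrite -big_filter -[RHS]big_filter; apply: perm_big; apply: uniq_perm.
- by rewrite filter_uniq // uniq_words.
- by rewrite filter_uniq.
- by move=> w; rewrite !mem_filter andbC.
Qed.

End Words.

Section MonomialSpans.
Variables (K : fieldType) (C : weierstrass_curve K).
Local Notation L := (ec_L C).
Local Notation Omega := (ec_Omega C).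
Local Notation ncs := (@series K C L^o).
Local Notation monomial := (@monomial K C).
Implicit Types (u : ncs) (w : word) (D : set word).

Lemma monomial_eq w w' : monomial w w' = (w' == w)%:R.
Proof. by rewrite /Defs.monomial; case: eqP. Qed.

Lemma series_sum n u : (forall w, (n < size w)%N -> u w = 0) ->
  u = \sum_(w <- words n) (u w : L) *: monomial w.
Proof.
move=> un; apply/funext => w'; rewrite fct_sumE.
have [wn|wn] := leqP (size w') n.
  rewrite (@sum_words_supp _ _ _ [:: w']) //=.
  - by rewrite big_seq1 /GRing.scale /= monomial_eq eqxx [RHS]mulr1.
  - move=> w _; rewrite mem_seq1 => ww; rewrite /GRing.scale /= monomial_eq eq_sym (negbTE ww).
    exact: mulr0.
  - by move=> w; rewrite mem_seq1 => /eqP ->; rewrite ltnNge wn.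
rewrite un // big1_seq // => w /=; rewrite mem_words => ww.
rewrite /GRing.scale /= monomial_eq; case: eqP => [e|_]; last exact: mulr0.
by move: wn; rewrite e ltnNge ww.
Qed.

Lemma span_monomialsP (R : set L) D n u : is_subalgebra R ->
  (forall w, D w -> (size w <= n)%N) ->
  Defs.span R [set monomial w | w in D] u <->
  (forall w, R (u w)) /\ (forall w, ~ D w -> u w = 0).
Proof.
move=> RR Dn; split=> [|[Ru Du]].
  move: u; apply: span_min => [|u u' [Ru Du] [Ru' Du']|c _ Rc [w Dw <-]].
  - by split=> // w; exact: subalg0.
  - split=> w; first exact: (subalg_add RR).
    by move=> nD; rewrite addrfctE Du // Du' // addr0.
  - split=> w'; rewrite /GRing.scale /= monomial_eq.
      by apply: (subalg_mul RR) => //; exact: subalg_nat.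
    by move=> nD; case: eqP nD => [->//|] _ _; exact: mulr0.
rewrite (@series_sum n u) => [|w wn]; last by apply: Du => /Dn; rewrite leqNgt wn.
apply: span_sum => w _; have [Dw|nD] := pselect (D w); last first.
  by rewrite Du // scale0r; exact: span0.
apply: span_scale => [c Rc|]; first exact: (subalg_mul RR).
by apply: span_gen; [exact: subalg1|exists w].
Qed.

Lemma tensor_intro (R : set L) (F : set ncs) (W : set Omega) n (t : series Omega) :
  is_subalgebra R -> (forall w, W (t w)) -> (forall w, (n < size w)%N -> t w = 0) ->
  (forall w, t w <> 0 -> F (monomial w)) -> tensor R F W t.
Proof.
move=> RR Wt tn tF.
have -> : t = \sum_(w <- words n) (fun w' => (monomial w w' : L) *: t w).
  apply/funext => w'; rewrite fct_sumE.
  have [wn|wn] := leqP (size w') n.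
    rewrite (@sum_words_supp _ _ _ [:: w']) //=.
    - by rewrite big_seq1 monomial_eq eqxx scale1r.
    - by move=> w _; rewrite mem_seq1 => ww; rewrite monomial_eq eq_sym (negbTE ww) scale0r.
    - by move=> w; rewrite mem_seq1 => /eqP ->; rewrite ltnNge wn.
  rewrite tn // big1_seq // => w /=; rewrite mem_words => ww.
  rewrite monomial_eq; case: eqP => [e|_]; last by rewrite scale0r.
  by move: wn; rewrite e ltnNge ww.
apply: span_sum => w _; have [->|tw] := pselect (t w = 0).
  have -> : (fun w' => (monomial w w' : L) *: (0 : Omega)) = 0.
    by apply/funext => w'; rewrite scaler0.
  exact: span0.
apply: span_gen; first exact: subalg1.
by exists (monomial w), (t w); split=> //; exact: tF.
Qed.

(** The form in which transversality is used: a linear relation among the coefficients of all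
    members of [F] persists for [F] tensored with differentials. *)
Lemma tensor_relation (R : set L) (F : set ncs) (W : set Omega) (v : word)
    (phi : word -> L) (s : seq word) (t : series Omega) :
  (forall u, F u -> u v = \sum_(w <- s) phi w * u w) ->
  tensor R F W t -> t v = \sum_(w <- s) phi w *: t w.
Proof.
move=> H; move: t; apply: span_min => [|t t' Ht Ht'|c _ _ [u [om [Fu _ ->]]]].
- by rewrite big1 // => w _; rewrite scaler0.
- rewrite addrfctE Ht Ht' -big_split /=.
  by apply: eq_bigr => w _; rewrite -scalerDr.
- rewrite scalrfctE H // scaler_suml scaler_sumr; apply: eq_bigr => w _.
  by rewrite !scalerA; congr (_ *: _); rewrite [phi w * c]mulrC; exact: mulrA.
Qed.

End MonomialSpans.

Section WordFiltration.
Variables (K : fieldType) (C : weierstrass_curve K).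
Local Notation L := (ec_L C).
Local Notation Omega := (ec_Omega C).
Local Notation ncs := (@series K C L^o).
Local Notation monomial := (@monomial K C).
Implicit Types (u : ncs) (w : word) (U : set (point C)) (f h : L) (j : int) (om : series Omega).

(** Over X this is [word_filtration] by conversion; over Y it is the candidate for the other half of
    the filtration. *)
Definition word_fil U n j : set ncs :=
  Defs.span (sections U)
    [set monomial w | w in [set w | (size w <= n)%N /\ (degA w)%:Z <= - j]].

Lemma word_filP U n j u : word_fil U n j u <->
  (forall w, sections U (u w)) /\
  (forall w, ~ ((size w <= n)%N /\ (degA w)%:Z <= - j) -> u w = 0).
Proof. by apply: (@span_monomialsP _ _ _ _ n _ (sections_subalgebra U)) => w []. Qed.

Lemma tensor_power_filP U n j u : tensor_power_fil U n j u <->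
  (forall w, sections U (u w)) /\
  (forall w, ~ (size w = n /\ (degA w)%:Z <= - j) -> u w = 0).
Proof. by apply: (@span_monomialsP _ _ _ _ n _ (sections_subalgebra U)) => w [-> _]. Qed.

Lemma levelP (R : set L) n u :
  level R n u <-> (forall w, R (u w)) /\ (forall w, (n < size w)%N -> u w = 0).
Proof.
split=> -[Ru un]; split=> //.
  by move=> w wn; rewrite -un /trunc leqNgt wn.
by apply/funext => w; rewrite /trunc; case: leqP => // /un ->.
Qed.

Section Submodule.
Variables (R : set L) (RR : is_subalgebra R) (D : set word) (n : nat).

Lemma supported_submodule :
  is_submodule R (level R n)
    [set u : ncs | (forall w, R (u w)) /\ forall w, ~ ((size w <= n)%N /\ D w) -> u w = 0].
Proof.
split=> [u [Ru Du]||u u' [Ru Du] [Ru' Du']|c u Rc [Ru Du]].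
- by apply/levelP; split=> // w wn; apply: Du => -[]; rewrite leqNgt wn.
- by split=> // w; exact: subalg0.
- split=> w; first exact: (subalg_add RR).
  by move=> nD; rewrite addrfctE Du // Du' // addr0.
- split=> w; first exact: (subalg_mul RR).
  by move=> nD; rewrite scalrfctE Du // scaler0.
Qed.

End Submodule.

Lemma word_fil_subbundle U n j :
  is_subbundle (sections U) (level (sections U) n) (word_fil U n j).
Proof.
have RR := sections_subalgebra U.
have E : word_fil U n j = [set u : ncs | (forall w, sections U (u w)) /\
    forall w, ~ ((size w <= n)%N /\ (degA w)%:Z <= - j) -> u w = 0].
  by apply/seteqP; split=> u /word_filP.
split; first by rewrite E; exact: supported_submodule.
exists [set u : ncs | (forall w, sections U (u w)) /\
    forall w, ~ ((size w <= n)%N /\ ~ (degA w)%:Z <= - j) -> u w = 0]; split.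
- exact: supported_submodule.
- move=> u /word_filP[_ Fu] [_ Gu]; apply/funext => w.
  have [jw|jw] := pselect ((degA w)%:Z <= - j); last by apply: Fu => -[].
  by apply: Gu => -[].
- move=> u /levelP[Ru un].
  exists (fun w => if (degA w)%:Z <= - j then u w else 0),
    (fun w => if (degA w)%:Z <= - j then 0 else u w); split.
  + apply/word_filP; split=> w; first by case: ifP => // _; exact: subalg0.
    by case: ifP => // jw nD; apply: un; rewrite ltnNge; apply/negP => wn; apply: nD.
  + split=> w; first by case: ifP => // _; exact: subalg0.
    case: ifP => // /negP jw nD; apply: un; rewrite ltnNge; apply/negP => wn.
    by apply: nD; split=> //; exact/negP.
  + apply/funext => w; rewrite addrfctE; case: ifP => _; by rewrite ?addr0 ?add0r.
Qed.

Lemma degA_split i w : degA w = (degA (take i w) + degA (drop i w))%N.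
Proof. by rewrite -count_cat cat_take_drop. Qed.

Lemma degA_size w : (degA w <= size w)%N.
Proof. exact: count_size. Qed.

Lemma monomial_word_fil U n j w : (size w <= n)%N -> (degA w)%:Z <= - j ->
  word_fil U n j (monomial w).
Proof.
by move=> wn wj; apply: span_gen; [exact: subalg1 (sections_subalgebra U)|exists w].
Qed.

(** Only the bound on the A-degree of the form and its logarithmic poles matter, so the same
    argument serves both charts. *)
Lemma word_fil_log_filtration U om n :
  (forall w, log_sections U (om w)) -> (forall w, (1 < degA w)%N -> om w = 0) ->
  log_filtration_on U om n (word_fil U n).
Proof.
move=> Uom om2; have RR := sections_subalgebra U; split.
- exact: word_fil_subbundle.
- move=> j k jk u /word_filP[Ru Du]; apply/word_filP; split=> // w nD.
  by apply: Du => -[wn wk]; apply: nD; split=> //; lia.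
- exists (- n%:Z); apply/seteqP; split=> u.
    move=> /word_filP[Ru Du]; apply/levelP; split=> // w wn; apply: Du => -[].
    by rewrite leqNgt wn.
  move=> /levelP[Ru Du]; apply/word_filP; split=> // w nD; apply: Du.
  rewrite ltnNge; apply/negP => wn; apply: nD; split=> //.
  have := degA_size w; lia.
- exists 1; apply/seteqP; split=> u.
    by move=> /word_filP[Ru Du]; apply/funext => w; apply: Du => -[_]; lia.
  by move=> ->; exact: span0.
- move=> j u /word_filP[Ru Du].
  apply: (@tensor_intro _ _ _ _ _ n) => // w.
  + rewrite /connection /trunc; case: ifP => _; last exact: log_sections0.
    apply: log_sections_add; first exact: log_sections_d.
    rewrite -sumrN; elim/big_ind: _ => [||i _]; first exact: log_sections0.
      by move=> *; exact: log_sections_add.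
    by rewrite -scaleNr; apply: log_sections_scale => //; exact: (subalg_opp RR).
  + by move=> wn; rewrite /connection /trunc leqNgt wn.
  + rewrite /connection /trunc; case: ifP => // wn cw; apply: monomial_word_fil => //.
    rewrite leNgt; apply/negP => wj; apply: cw.
    rewrite Du => [|[_ wj']]; last lia.
    rewrite ec_d0 sub0r big1 ?oppr0 // => i _.
    have [t2|t2] := leqP (degA (take i w)) 1; last by rewrite om2 // scaler0.
    rewrite Du ?scale0r // => -[_]; have := degA_split i w; lia.
Qed.

Lemma iter_gauge m f w :
  iter m (fun u : ncs => ncmul ((- f) *: serB C) u) (monomial [::]) w
  = if w == nseq m false then (- f) ^+ m else 0.
Proof.
elim: m w => [|m IH] w; first by rewrite expr0.
have -> : iter m.+1 (fun u : ncs => ncmul ((- f) *: serB C) u) (monomial [::]) w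
   = - f * ncmul (serB C) (iter m (fun u : ncs => ncmul ((- f) *: serB C) u) (monomial [::])) w.
  rewrite iterS /ncmul mulr_sumr; apply: eq_bigr => i _.
  by rewrite scalrfctE /GRing.scale /=; exact/esym/mulrA.
rewrite ncmul_serB IH; case: w => [|a w]; first by rewrite /= mul0r mulr0.
rewrite /= take0 drop0 eqseq_cons andbT [in RHS]eqseq_cons.
by case: eqP => _ /=; [rewrite mul1r; case: eqP => _; rewrite ?mulr0 ?exprS|rewrite mul0r mulr0].
Qed.

Lemma gaugeE f w : gauge f w =
  if w == nseq (size w) false then (size w)`!%:R^-1 * (- f) ^+ (size w) else 0.
Proof.
rewrite /gauge big_ord_recr big1 => [|i _] /=; last first.
  rewrite iter_gauge; case: eqP => [e|_]; last by rewrite mulr0.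
  by have := congr1 (@size letter) e; rewrite size_nseq; have := ltn_ord i; lia.
by rewrite iter_gauge add0r; case: ifP => _; rewrite ?mulr0.
Qed.

Lemma gauge0 f : gauge f [::] = 1.
Proof. by rewrite gaugeE /= fact0 invr1 mulr1. Qed.

Lemma gauge_degA f w : (0 < degA w)%N -> gauge f w = 0.
Proof.
rewrite gaugeE; case: eqP => // ->.
by rewrite /degA count_nseq mul0n.
Qed.

Lemma gauge_subalgebra (R : set L) f w : is_subalgebra R -> R f -> R (gauge f w).
Proof.
move=> RR Rf; rewrite gaugeE; case: ifP => _; last exact: subalg0.
apply: (subalg_mul RR); first exact: subalg_natV.
by apply: (subalg_exp RR); exact: subalg_opp.
Qed.

End WordFiltration.

(** * Existence: logarithmic poles and the gauge transformation *)

Section Existence.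
Variables (K : fieldType) (C : weierstrass_curve K).
Hypothesis (K0 : [pchar K] =i pred0).
Local Notation L := (ec_L C).
Local Notation ncs := (@series K C L^o).
Local Notation monomial := (@monomial K C).
Variables (P : nat -> L) (f : L).
Hypotheses (P_def : is_P P) (f_def : is_f f).
Implicit Types (u : ncs) (w : word) (U : set (point C)) (j : int).

Lemma coefX_regular k (m : affine_point C) : stalk (Some m) (coefX P k).
Proof.
have SR := stalk_subalgebra (Some m).
rewrite /coefX; case: ifP => k2; last exact: subalg0.
apply: (subalg_opp SR); apply: (subalg_mul SR); last exact: subalg_natV.
apply: (subalg_mul SR); last by have [PX _] := P_def k2; exact: PX.
by apply: (subalg_exp SR); apply: (subalg_opp SR); exact: subalg1.
Qed.

Lemma beta_regular (m : affine_point C) : kaehler_stalk (Some m) (beta C).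
Proof.
apply: kaehler_stalk_scale; last exact: alpha_regular.
by apply: sections_opX => //; exact: coord_ring_x.
Qed.

Lemma serB_stalk (Q : point C) w : stalk Q (serB C w).
Proof.
rewrite /serB /Defs.monomial; have SR := stalk_subalgebra Q.
by case: ifP => _; [exact: subalg1|exact: subalg0].
Qed.

Lemma kzb_form_log w : log_sections (@opX K C) (kzb_form P w).
Proof.
move=> [m|] //= _; apply: span_add; apply: kaehler_stalk_scale.
- exact: serB_stalk.
- exact: beta_regular.
- by apply: exp_ad_subalgebra (stalk_subalgebra _) _ => k; exact: coefX_regular.
- exact: alpha_regular.
Qed.

(** At infinity the choice of [f] replaces [beta], with its double pole, by a regular form; the
    coefficient of [alpha] has at most a simple pole by [exp_coefY_pole]. *)
Lemma kzb_form'_log w : log_sections (opY f) (kzb_form' P f w).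
Proof.
have SR := @stalk_subalgebra K C.
move=> Q; case: Q => [m [//|Qf]|_]; rewrite /kzb_form'; apply: log_stalk_add.
- apply: log_stalk_scale; first exact: serB_stalk.
  apply: span_add; first exact: beta_regular.
  rewrite -scaleN1r; apply: kaehler_stalk_scale; last exact: kaehler_stalk_d.
  by apply: (subalg_opp (SR _)); exact: subalg1.
- apply: log_stalk_scale; last exact: alpha_regular.
  apply: exp_ad_subalgebra (SR _) _ => k; rewrite /coefY.
  by case: ifP => _; [exact: (subalg_opp (SR _))|exact: coefX_regular].
- apply: log_stalk_scale; first exact: serB_stalk.
  apply: kaehler_stalk_log; have [df _ _ _] := f_def.
  rewrite -opprB -scaleN1r; apply: kaehler_stalk_scale => //.
  by apply: (subalg_opp (SR _)); exact: subalg1.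
- have [s1 s2] := uniformizer f_def.
  by apply: (alpha_log K0 s1 s2); exact: exp_coefY_pole.
Qed.

Lemma serB_degA w : (0 < degA w)%N -> serB C w = 0.
Proof. by rewrite /serB /Defs.monomial; case: eqP => // ->. Qed.

Lemma kzb_form_degA w : (1 < degA w)%N -> kzb_form P w = 0.
Proof.
move=> w1; rewrite /kzb_form serB_degA; last lia.
by rewrite exp_ad_degA ?scale0r ?addr0 //; lia.
Qed.

Lemma kzb_form'_degA w : (1 < degA w)%N -> kzb_form' P f w = 0.
Proof.
move=> w1; rewrite /kzb_form' serB_degA; last lia.
by rewrite exp_ad_degA ?scale0r ?addr0 //; lia.
Qed.

Lemma f_sectionsXY : sections (@opX K C `&` opY f) f.
Proof. by move=> Q [QX [QN|]] //; case: QX. Qed.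

Lemma sections_anti U U' h : U' `<=` U -> sections U h -> sections U' h.
Proof. by move=> UU H Q /UU; exact: H. Qed.

Lemma word_fil_anti U U' n j : U' `<=` U -> word_fil U n j `<=` word_fil U' n j.
Proof.
move=> UU u /word_filP[Ru Du]; apply/word_filP; split=> // w.
exact: sections_anti (Ru w).
Qed.

Lemma gauge_word_fil U n j u : sections U f -> word_fil U n j u ->
  word_fil U n j (trunc n (ncmul (gauge f) u)).
Proof.
move=> Uf /word_filP[Ru Du]; have RR := sections_subalgebra U.
apply/word_filP; split=> w.
  rewrite /trunc; case: ifP => _; last exact: subalg0.
  by apply: (subalg_sum RR) => i _; apply: (subalg_mul RR) => //; exact: (gauge_subalgebra _ RR Uf).
rewrite /trunc; case: ifP => // wn nD; apply: big1 => i _.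
have [t0|t0] := posnP (degA (take i w)); last by rewrite gauge_degA // scale0r.
rewrite Du ?scaler0 // => -[_ wj]; apply: nD; split=> //.
by rewrite (degA_split i) t0.
Qed.

Lemma gauge_monomial n w w' : (size w' <= size w)%N -> (size w <= n)%N ->
  trunc n (ncmul (gauge f) (monomial w)) w' = (w' == w)%:R.
Proof.
move=> ww wn; rewrite /trunc (leq_trans ww wn) /ncmul big_ord_recl big1 => [|i _].
  by rewrite take0 drop0 gauge0 scale1r addr0 monomial_eq.
rewrite monomial_eq; case: eqP => [e|_]; last by rewrite scaler0.
have := congr1 (@size letter) e; rewrite size_drop /= /bump /=.
have := ltn_ord i; lia.
Qed.

(* The gauge transformation is unitriangular for the length of words. *)
Lemma gauge_generates U n j u (G : set ncs) : sections U f ->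
  (forall w, (size w <= n)%N -> (degA w)%:Z <= - j -> G (trunc n (ncmul (gauge f) (monomial w)))) ->
  word_fil U n j u -> Defs.span (sections U) G u.
Proof.
move=> Uf HG; have RR := sections_subalgebra U.
suff H k : (k <= n.+1)%N -> forall u, word_fil U n j u ->
    (forall w, (size w < n.+1 - k)%N -> u w = 0) -> Defs.span (sections U) G u.
  move=> Fu; apply: (H n.+1) => // w; by rewrite subnn.
elim: k => [|k IH] kn {}u Fu u0.
  have [_ Du] := (word_filP _ _ _ _).1 Fu; suff -> : u = 0 by exact: span0.
  apply/funext => w; have [wn|wn] := leqP (size w) n; first by apply: u0; lia.
  by apply: Du => -[]; lia.
pose m := (n.+1 - k.+1)%N.
(* The gauge image of the part of [u] in the lowest length [m]. It agrees with [u] up to that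
   length, so [u - s] starts in length [m + 1] and the induction applies. *)
pose s := \sum_(w <- words n | size w == m) (u w : L) *: trunc n (ncmul (gauge f) (monomial w)).
have [Ru Du] := (word_filP _ _ _ _).1 Fu.
have Hs (S : set ncs) : S 0 -> (forall u u', S u -> S u' -> S (u + u')) ->
    (forall w, (size w <= n)%N -> (degA w)%:Z <= - j ->
      S ((u w : L) *: trunc n (ncmul (gauge f) (monomial w)))) -> S s.
  move=> S0 SD SZ; rewrite /s big_seq_cond; elim/big_ind: _ => // w.
  rewrite mem_words => /andP[wn _]; have [wj|wj] := pselect ((degA w)%:Z <= - j).
    exact: SZ.
  by rewrite Du ?scale0r // => -[].
have Ss : Defs.span (sections U) G s.
  apply: Hs; [exact: span0|exact: span_add|move=> w wn wj].
  apply: span_scale; first by move=> c; exact: (subalg_mul RR).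
  by apply: span_gen; [exact: subalg1|exact: HG].
have Fs : word_fil U n j s.
  apply: Hs; [exact: span0|exact: span_add|move=> w wn wj].
  apply: span_scale; first by move=> c; exact: (subalg_mul RR).
  by apply: gauge_word_fil => //; exact: monomial_word_fil.
rewrite -(subrK s u); apply: span_add => //; apply: IH; first lia.
  apply: span_add => //; rewrite -scaleN1r; apply: span_scale => //.
  by move=> c Rc; apply: (subalg_mul RR) => //; apply: (subalg_opp RR); exact: subalg1.
move=> w wk; have wm : (size w <= m)%N by rewrite /m; lia.
have -> : (u - s) w = u w - s w by [].
apply/eqP; rewrite subr_eq0; apply/eqP.
rewrite /s fct_sumE; have [ew|ew] := eqVneq (size w) m.
  rewrite big_mkcond (@sum_words_supp _ _ _ [:: w]) //=.
  - rewrite big_seq1 ew eqxx scalrfctE gauge_monomial ?eqxx //; last by rewrite ew /m; lia.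
    by rewrite [RHS]mulr1.
  - move=> w' w'n; rewrite mem_seq1 => ww; case: eqP => // w'm.
    rewrite scalrfctE gauge_monomial; [|by rewrite ew w'm|done].
    by rewrite eq_sym (negbTE ww) scaler0.
  - by move=> w'; rewrite mem_seq1 => /eqP ->; rewrite ew /m; lia.
rewrite u0; last by move: ew wm; rewrite /m; lia.
rewrite big1_seq // => w' /andP[/eqP w'm]; rewrite mem_words => w'n.
rewrite scalrfctE gauge_monomial ?w'm //; last by rewrite -w'm.
by case: eqP => [e|_]; [rewrite e w'm eqxx in ew|rewrite scaler0].
Qed.

End Existence.

Section HodgeExistence.
Variables (K : fieldType) (C : weierstrass_curve K).
Hypothesis (K0 : [pchar K] =i pred0).
Local Notation L := (ec_L C).
Local Notation ncs := (@series K C L^o).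
Local Notation monomial := (@monomial K C).
Variables (P : nat -> L) (f : L) (b1 b2 : K).
Hypotheses (P_def : is_P P) (f_def : is_f f).
Implicit Types (u : ncs) (w : word) (U : set (point C)) (j : int).

(** The gauge involves only B, so it preserves the filtration by A-degree; unitriangularity gives
    the reverse inclusion. Both need [f] to be regular, which holds over the intersection. *)
Lemma word_fil_glue n j :
  Defs.span (sections (@opX K C `&` opY f))
    [set trunc n (ncmul (gauge f) u) | u in word_fil (@opX K C) n j]
  = Defs.span (sections (@opX K C `&` opY f)) (word_fil (opY f) n j).
Proof.
have RR := sections_subalgebra (@opX K C `&` opY f).
have fXY := @f_sectionsXY K C f.
have min G : G `<=` word_fil (@opX K C `&` opY f) n j ->
    Defs.span (sections (@opX K C `&` opY f)) G `<=` word_fil (@opX K C `&` opY f) n j.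
  move=> HG; apply: span_min; [exact: span0|exact: span_add|move=> c g Rc Gg].
  by apply: span_scale; [move=> *; exact: (subalg_mul RR)|exact: HG].
apply/seteqP; split=> u.
  move=> /min{}H; have {}H : word_fil (@opX K C `&` opY f) n j u.
    apply: H => _ [u' Fu' <-]; apply: gauge_word_fil => //.
    by apply: word_fil_anti Fu' => Q [].
  move: u H; apply: span_min; [exact: span0|exact: span_add|].
  move=> c _ Rc [w [wn wj] <-]; apply: span_scale.
    by move=> *; exact: (subalg_mul RR).
  by apply: span_gen; [exact: subalg1|exact: monomial_word_fil].
move=> /min{}H; apply: (@gauge_generates _ _ _ _ n j u _ fXY) => [w wn wj|].
  by exists (monomial w) => //; exact: monomial_word_fil.
by apply: H; apply: word_fil_anti => Q [].
Qed.

Lemma word_fil_exact U : filtered_exact U (word_fil U).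
Proof.
have RR := sections_subalgebra U; split=> n j.
  apply/seteqP; split=> u.
    move=> [/word_filP[Ru Du] un]; apply/tensor_power_filP; split=> // w nD.
    have [wn|/un//] := pselect (size w = n).
    by apply: Du => -[_ wj]; apply: nD.
  move=> /tensor_power_filP[Ru Du]; split.
    by apply/word_filP; split=> // w nD; apply: Du => -[wn wj]; apply: nD; rewrite wn.
  by move=> w wn; apply: Du => -[].
apply/seteqP; split=> u.
  move=> [u' /word_filP[Ru Du] <-]; apply/word_filP; split=> w.
    by rewrite /trunc; case: ifP => // _; exact: subalg0.
  rewrite /trunc; case: ifP => // wn nD; apply: Du => -[_ wj].
  by apply: nD.
move=> /word_filP[Ru Du]; exists u.
  apply/word_filP; split=> // w nD; apply: Du => -[wn wj]; apply: nD; split=> //.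
  exact: leqW.
apply/funext => w; rewrite /trunc; case: ifP => // wn; apply/esym/Du => -[].
by rewrite wn.
Qed.

Lemma word_filtration_hodge :
  is_hodge_filtration P f b1 b2 (@word_filtration K C).
Proof.
exists (word_fil (opY f)); split=> [n||]; try exact: word_fil_exact.
split.
- apply: word_fil_log_filtration => w; first exact: kzb_form_log.
  exact: kzb_form_degA.
- apply: word_fil_log_filtration => w; first exact: kzb_form'_log.
  exact: kzb_form'_degA.
- exact: word_fil_glue.
- exists (monomial [::]); first exact: monomial_word_fil.
  have e1 : eval_xy C 1 = 1.
    by rewrite -(rmorph1 (ec_iota C)) -(eval_xyC C) !polyC1.
  have e0 : eval_xy C 0 = 0 by rewrite -(subrr 1) eval_xyB subrr.
  have v1 : bieval 1 b1 b2 = 1 by rewrite /bieval !hornerE.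
  have v0 : bieval 0 b1 b2 = 0 by rewrite /bieval !horner0.
  move=> w; rewrite monomial_eq; case: eqP => _; [exists 1, 1|exists 0, 1].
    by rewrite e1 v1 !divr1 oner_eq0.
  by rewrite e1 v1 e0 v0 !mul0r oner_eq0.
Qed.

End HodgeExistence.

(** * Uniqueness *)

Section Lifts.
Variables (K : fieldType) (C : weierstrass_curve K).
Local Notation L := (ec_L C).
Local Notation ncs := (@series K C L^o).
Local Notation monomial := (@monomial K C).
Variables (U : set (point C)) (n : nat) (G : int -> set ncs).
Local Notation R := (sections U).
Implicit Types (u : ncs) (w v : word) (j : int).

Hypothesis G_sub : forall j, is_submodule R (level R n.+1) (G j).
Hypothesis G_dec : forall j k, j <= k -> G k `<=` G j.
Hypothesis G_ker : forall j, G j `&` [set u | forall w, size w <> n.+1 -> u w = 0]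
  = tensor_power_fil U n.+1 j.
Hypothesis G_quot : forall j, [set trunc n u | u in G j] = word_fil U n j.

Let RR := sections_subalgebra U.

Lemma G_opp j u : G j u -> G j (- u).
Proof.
move=> Gu; rewrite -scaleN1r; apply: (submod_scale (G_sub j)) => //.
by apply: (subalg_opp RR); exact: subalg1.
Qed.

Lemma G_sum j (r : seq word) (p : pred word) (X : word -> ncs) :
  (forall w, p w -> G j (X w)) -> G j (\sum_(w <- r | p w) X w).
Proof.
move=> H; elim/big_ind: _ => //; first exact: submod_0 (G_sub j).
exact: submod_add (G_sub j).
Qed.

(* The filtration G j is a graph over word_fil n j: the coefficient at v of degree
   n.+1, outside the kernel part, is a linear function of the lower coefficients. *)
Lemma lift_functional v : size v = n.+1 -> exists phi : word -> L,
  [/\ forall w, R (phi w),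
      forall w, ~ ((size w <= n)%N /\ (degA w < degA v)%N) -> phi w = 0,
      forall w, (size w <= n)%N -> (degA w < degA v)%N -> exists u,
        [/\ G (- (degA w)%:Z) u, trunc n u = monomial w & u v = phi w]
    & forall u, G (1 - (degA v)%:Z) u -> u v = \sum_(w <- words n) phi w * u w].
Proof.
move=> vn; set m := degA v.
have Glev j u : G j u -> (forall w, R (u w)) /\ (forall w, (n.+1 < size w)%N -> u w = 0).
  by move/(submod_sub (G_sub j))/levelP.
(* [l w] lifts the word [w] to level [n + 1] inside the filtration step of its own A-degree. *)
have [w|l lP] := @choice _ _ (fun w u => (size w <= n)%N ->
    G (- (degA w)%:Z) u /\ trunc n u = monomial w).
  have [wn|wn] := leqP (size w) n; last by exists 0.
  have : word_fil U n (- (degA w)%:Z) (monomial w).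
    by apply: monomial_word_fil => //; lia.
  by rewrite -G_quot => -[u Gu <-]; exists u.
pose phi w := if (size w <= n)%N && (degA w < m)%N then l w v else 0 : L.
have trunc_eq u w : (size w <= n)%N -> u w = trunc n u w by rewrite /trunc => ->.
exists phi; split.
- move=> w; rewrite /phi; case: ifP => [/andP[wn _]|_]; last exact: subalg0.
  by have [Gl _] := lP w wn; have [Rl _] := Glev _ _ Gl.
- by move=> w nD; rewrite /phi; case: ifP => // /andP.
- move=> w wn wm; exists (l w); have [Gl tl] := lP w wn; split=> //.
  by rewrite /phi wn wm.
move=> u Gu; have [Ru un] := Glev _ _ Gu.
have u0 w : (size w <= n)%N -> (m <= degA w)%N -> u w = 0.
  move=> wn wm; rewrite trunc_eq //.
  have : word_fil U n (1 - m%:Z) (trunc n u) by rewrite -G_quot; exists u.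
  by move=> /word_filP[_]; apply=> -[_]; lia.
pose s := \sum_(w <- words n) (u w : L) *: l w.
have Gs : G (1 - m%:Z) s.
  rewrite /s big_seq_cond; apply: G_sum => w; rewrite mem_words => /andP[wn _].
  have [wm|wm] := leqP m (degA w).
    by rewrite u0 // scale0r; exact: submod_0 (G_sub _).
  apply: (submod_scale (G_sub _)) => //; have [Gl _] := lP w wn.
  by apply: (G_dec _ Gl); lia.
(* [s] has the same lower coefficients as [u], so [u - s] lies in the kernel part. Step [1 - m] is
   the largest one whose words exclude [v], so the coefficient of [u - s] at [v] is 0. *)
have : tensor_power_fil U n.+1 (1 - m%:Z) (u - s).
  rewrite -G_ker; split; first by apply: (submod_add (G_sub _)) => //; exact: G_opp.
  move=> w wn; have -> : (u - s) w = u w - s w by [].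
  have [wn'|wn'] := leqP (size w) n; last first.
    have nw : (n.+1 < size w)%N by move/eqP: wn; lia.
    by rewrite un // (_ : s w = 0) ?subrr //; have [_ ->] := Glev _ _ Gs.
  apply/eqP; rewrite subr_eq0; apply/eqP; rewrite /s fct_sumE.
  rewrite (@sum_words_supp _ _ _ [:: w]) //=.
  - rewrite big_seq1 scalrfctE (trunc_eq (l w)) // (lP w wn').2 monomial_eq eqxx.
    exact/esym/mulr1.
  - move=> w' w'n; rewrite mem_seq1 => ww.
    rewrite scalrfctE (trunc_eq (l w')) // (lP w' w'n).2 monomial_eq eq_sym (negbTE ww).
    exact: scaler0.
  - by move=> w'; rewrite mem_seq1 => /eqP ->; rewrite ltnNge wn'.
move=> /tensor_power_filP[_ /(_ v)]; have -> : (u - s) v = u v - s v by [].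
move=> H; have /eqP : u v - s v = 0 by apply: H => -[_]; rewrite -/m; lia.
rewrite subr_eq0 => /eqP ->; rewrite /s fct_sumE; apply: eq_big_seq => w.
rewrite mem_words => wn; rewrite scalrfctE /phi wn /=; case: ifP => wm.
  exact: mulrC.
by rewrite u0 ?mul0r ?scale0r // leqNgt wm.
Qed.

(** When the functionals vanish, a lift of a shorter word differs from that word only by words of
    degree [n + 1] in the same filtration step, and these belong to the kernel part. *)
Lemma graph_zero : (forall j u v, G j u -> size v = n.+1 -> - j < (degA v)%:Z -> u v = 0) ->
  forall j, G j = word_fil U n.+1 j.
Proof.
move=> H j; have Gword w : (size w <= n.+1)%N -> (degA w)%:Z <= - j -> G j (monomial w).
  rewrite leq_eqVlt => /orP[/eqP wn|wn] wj.
    have : tensor_power_fil U n.+1 j (monomial w).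
      by apply: span_gen; [exact: subalg1|exists w].
    by rewrite -G_ker => -[].
  have : word_fil U n j (monomial w) by exact: monomial_word_fil.
  rewrite -G_quot => -[u Gu tu].
  have [Ru un] := (levelP _ _ _).1 (submod_sub (G_sub j) Gu).
  rewrite -[monomial w](subrK u); apply: (submod_add (G_sub j)) => //.
  rewrite -opprB; apply: G_opp.
  have : tensor_power_fil U n.+1 j (u - monomial w); last by rewrite -G_ker => -[].
  apply/tensor_power_filP; split=> w'.
    apply: (subalg_sub RR) => //; rewrite monomial_eq; exact: (subalg_nat RR).
  move=> nD; have -> : (u - monomial w) w' = u w' - monomial w w' by [].
  have [wn'|wn'] := leqP (size w') n.
    by rewrite -tu /trunc wn' subrr.
  rewrite monomial_eq; case: eqP => [e|_]; first by move: wn; rewrite -e ltnS leqNgt wn'.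
  rewrite subr0; have [e|ne] := eqVneq (size w') n.+1.
    by apply: (H j) => //; rewrite ltNge; apply/negP => wj'; apply: nD.
  by apply: un; lia.
apply/seteqP; split=> u; last first.
  apply: span_min; [exact: submod_0 (G_sub j)|exact: submod_add (G_sub j)|].
  by move=> c _ Rc [w [wn wj] <-]; apply: (submod_scale (G_sub j)) => //; exact: Gword.
move=> Gu; have [Ru un] := (levelP _ _ _).1 (submod_sub (G_sub j) Gu).
apply/word_filP; split=> // w nD.
have [wn|wn] := leqP (size w) n.+1; last exact: un.
have wj : - j < (degA w)%:Z by rewrite ltNge; apply/negP => wj; apply: nD.
move: wn; rewrite leq_eqVlt => /orP[/eqP wn|wn]; first exact: (H j).
have : word_fil U n j (trunc n u) by rewrite -G_quot; exists u.
move=> /word_filP[_ /(_ w)]; rewrite /trunc (_ : (size w <= n)%N); last by [].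
by apply=> -[_]; rewrite leNgt wj.
Qed.

End Lifts.

(** * Comparison of the two charts, transversality and the marked element *)

Section Uniqueness.
Variables (K : fieldType) (C : weierstrass_curve K).
Hypothesis (K0 : [pchar K] =i pred0).
Local Notation L := (ec_L C).
Local Notation iota := (@ec_iota K C).
Local Notation laurent := (@ec_laurent K C).
Local Notation d := (@ec_d K C).
Local Notation ncs := (@series K C L^o).
Local Notation monomial := (@monomial K C).
Local Notation X := (@opX K C).
Variables (P : nat -> L) (f : L) (b1 b2 : K).
Local Notation Y := (opY f).
Hypotheses (P_def : is_P P) (f_def : is_f f) (b_on_X : on_curve C b1 b2).
Implicit Types (u : ncs) (w v : word) (j : int).

(** [h] is regular on X with at most a simple pole at infinity, hence constant; its coefficient at
    [z^-1] is [c], because that of [f] is -1. The case [c = 0] serves for functions regular on both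
    charts. *)
Lemma global_const h k c : sections X h -> stalk None k -> h = k - f * iota c ->
  c = 0 /\ exists c', h = iota c'.
Proof.
move=> Xh Nk e; have [f1 f2] := ord_f f_def.
have h1 : ord_ge h (-1).
  rewrite e; apply: ord_ge_add; first by apply: (ord_ge_le (N := 0)).
  by apply: ord_ge_opp; rewrite mulrC; exact: ord_ge_constM.
have [c' ec'] := coord_ring_const K0 (sections_opXP Xh) h1; split; last by exists c'.
have : laurent h (-1) = c.
  by rewrite e laurentB Nk // mulrC laurent_constM f2 mulrN1 sub0r opprK.
by rewrite ec' ec_laurent_const.
Qed.

Lemma ncmul_trunc (a u : ncs) n w : (size w <= n)%N -> ncmul a u w = ncmul a (trunc n u) w.
Proof.
move=> wn; apply: eq_bigr => i _; rewrite /trunc size_drop.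
by rewrite (leq_trans (leq_subr _ _) wn).
Qed.

Lemma gauge_monomial_eq0 w w' :
  (forall k, w' != nseq k false ++ w) -> ncmul (gauge f) (monomial w) w' = 0.
Proof.
move=> H; apply: big1 => i _; rewrite gaugeE monomial_eq.
case: eqP => [et|_]; last by rewrite scale0r.
case: eqP => [ed|_]; last by rewrite scaler0.
by have := H (size (take i w')); rewrite -et -ed cat_take_drop eqxx.
Qed.

Lemma gauge_monomial_self w : ncmul (gauge f) (monomial w) w = 1.
Proof.
have := @gauge_monomial _ _ f (size w) w w (leqnn _) (leqnn _).
by rewrite /trunc leqnn eqxx.
Qed.

Lemma gauge_monomial_B w : ncmul (gauge f) (monomial w) (false :: w) = - f.
Proof.
rewrite /ncmul big_ord_recl big_ord_recl big1 => [|i _].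
  rewrite /= addr0 take0 drop0 !monomial_eq eqxx.
  have -> : (false :: w == w) = false.
    by apply/eqP => e; have := congr1 (@size letter) e; rewrite /=; lia.
  by rewrite scaler0 add0r gaugeE /= invr1 mul1r; exact: mulr1.
rewrite monomial_eq; case: eqP => [e|_]; last by rewrite scaler0.
have := congr1 (@size letter) e; rewrite size_drop !lift0 /= subSS.
have : (i < size w)%N := ltn_ord i; lia.
Qed.

Section Step.
Variables (n : nat) (G G' : int -> set ncs).
Hypothesis G_plf : pointed_log_filtration P f b1 b2 n.+1 G G'.
Hypothesis G_ker : forall j, G j `&` [set u | forall w, size w <> n.+1 -> u w = 0]
  = tensor_power_fil X n.+1 j.
Hypothesis G'_ker : forall j, G' j `&` [set u | forall w, size w <> n.+1 -> u w = 0]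
  = tensor_power_fil Y n.+1 j.
Hypothesis G_quot : forall j, [set trunc n u | u in G j] = word_fil X n j.
Hypothesis G'_quot : forall j, [set trunc n u | u in G' j] = word_fil Y n j.

Section Coefficient.
Variables (v : word) (phi phi' : word -> L).
Local Notation m := (degA v).
Hypothesis v_size : size v = n.+1.
Hypothesis phi_X : forall w, sections X (phi w).
Hypothesis phi'_Y : forall w, sections Y (phi' w).
Hypothesis phi_out : forall w, ~ ((size w <= n)%N /\ (degA w < m)%N) -> phi w = 0.
Hypothesis phi'_out : forall w, ~ ((size w <= n)%N /\ (degA w < m)%N) -> phi' w = 0.
Hypothesis phi_lift : forall w, (size w <= n)%N -> (degA w < m)%N -> exists u,
  [/\ G (- (degA w)%:Z) u, trunc n u = monomial w & u v = phi w].
Hypothesis phi_rel : forall u, G (1 - m%:Z) u -> u v = \sum_(w <- words n) phi w * u w.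
Hypothesis phi'_rel : forall u, G' (1 - m%:Z) u -> u v = \sum_(w <- words n) phi' w * u w.

Let G_dec := lf_decreasing (plf_X G_plf).

(* The gauge transformation relates phi w to the values of phi' at w, Bw, B^2 w, ... *)
Lemma phi_glue w : (size w <= n)%N -> (degA w < m)%N ->
  phi w = \sum_(w' <- words n) phi' w' * ncmul (gauge f) (monomial w) w'.
Proof.
move=> wn wm; have [u [Gu tu uv]] := phi_lift wn wm.
have : Defs.span (sections (X `&` Y)) (G' (1 - m%:Z)) (trunc n.+1 (ncmul (gauge f) u)).
  rewrite -(plf_glue G_plf); apply: span_gen.
    exact: subalg1 (sections_subalgebra _).
  by exists u => //; apply: (G_dec _ Gu); lia.
set g := trunc _ _ => Hg.
have {Hg} : g v = \sum_(w <- words n) phi' w * g w.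
  move: g Hg; apply: span_min => [|u1 u2 H1 H2|c u1 _ Gu1].
  - by rewrite big1 // => w' _; rewrite mulr0.
  - by rewrite addrfctE H1 H2 -big_split; apply: eq_bigr => w' _; rewrite mulrDr.
  - rewrite scalrfctE phi'_rel // scaler_sumr; apply: eq_bigr => w' _.
    exact: mulrCA.
have -> : g v = phi w.
  rewrite /g /trunc v_size leqnn /ncmul big_ord_recl take0 drop0 gauge0 scale1r uv.
  rewrite big1 ?addr0 // => i _; rewrite lift0.
  have [t0|t0] := posnP (degA (take i.+1 v)); last by rewrite gauge_degA // scale0r.
  have -> : u (drop i.+1 v) = trunc n u (drop i.+1 v).
    by rewrite /trunc size_drop ifT //; move: v_size; lia.
  rewrite tu monomial_eq; case: eqP => [e|_]; last by rewrite scaler0.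
  by move: wm; rewrite (degA_split i.+1 v) t0 e ltnn.
move=> ->; apply: eq_big_seq => w'; rewrite mem_words => wn'; congr (_ * _).
by rewrite /g /trunc (leqW wn') (ncmul_trunc _ _ wn') tu.
Qed.

(** The hypothesis on longer words is the induction hypothesis of [phi'_B]: it removes the terms at
    [B^k w] for k >= 2. *)
Lemma phi_glue2 w : (size w <= n)%N -> (degA w < m)%N ->
  (forall w', (size w < size w')%N -> phi' (false :: w') = 0) ->
  phi w = phi' w - f * phi' (false :: w).
Proof.
move=> wn wm H; rewrite phi_glue // (@sum_words_supp _ _ _ [:: w; false :: w]).
- rewrite !big_cons big_nil addr0 gauge_monomial_self gauge_monomial_B mulr1.
  by rewrite mulrN mulrC.
- rewrite /= andbT mem_seq1; apply/eqP => e; have := congr1 (@size letter) e; rewrite /=; lia.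
- move=> w' wn'; rewrite !inE negb_or => /andP[w1 w2].
  have [[k /eqP ek]|nk] := pselect (exists k, w' == nseq k false ++ w); last first.
    rewrite gauge_monomial_eq0 ?mulr0 // => k; apply/negP => ek; apply: nk; by exists k.
  case: k ek => [|[|k]] ek; [by rewrite ek eqxx in w1|by rewrite ek eqxx in w2|].
  by rewrite ek /= H ?mul0r // /= size_cat; lia.
- move=> w'; rewrite !inE => /orP[/eqP ->|/eqP ->] wn'; first by move: wn'; rewrite ltnNge wn.
  by rewrite phi'_out ?mul0r // => -[]; rewrite leqNgt wn'.
Qed.

(** Descending induction on the length of [w]. At Bw the correction term vanishes by induction, so
    [phi] and [phi'] agree there and equal a constant [c]; at [w] the relation reads
    [phi w = phi' w - f c], and the pole of [f] forces [c = 0]. *)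
Lemma phi'_B w : phi' (false :: w) = 0.
Proof.
have [k] := ubnP (n.+1 - size w)%N; elim: k w => // k IH w wk.
have [wn|wn] := leqP (size (false :: w)) n; last first.
  by apply: phi'_out => -[]; rewrite leqNgt wn.
have [wm|wm] := leqP m (degA w).
  by apply: phi'_out => -[_]; rewrite /degA /= add0n ltnNge wm.
have IH' w' : (size w < size w')%N -> phi' (false :: w') = 0.
  by move=> ww; apply: IH; have : (size w < n)%N := wn; lia.
have e1 := phi_glue2 (ltnW wn) wm IH'.
have e2 : phi (false :: w) = phi' (false :: w).
  rewrite phi_glue2 //; first by rewrite (IH' (false :: w)) ?mulr0 ?subr0 //=.
  by move=> w' ww; apply: IH'; apply: leq_trans ww.
have [||_ [c ec]] := @global_const (phi (false :: w)) (phi' (false :: w)) 0 (phi_X _).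
- by apply: phi'_Y; left.
- by rewrite rmorph0 mulr0 subr0 e2.
have [||c0 _] := @global_const (phi w) (phi' w) c (phi_X _);
  last by rewrite -e2 ec c0 rmorph0.
- by apply: phi'_Y; left.
- by rewrite -ec e2.
Qed.

Lemma phi_eq w : phi w = phi' w.
Proof.
have [[wn wm]|nD] := pselect ((size w <= n)%N /\ (degA w < m)%N); last first.
  by rewrite phi_out // phi'_out.
by rewrite phi_glue2 // => [|w' _]; rewrite phi'_B // mulr0 subr0.
Qed.

Lemma phi_const w : exists c, phi w = iota c.
Proof.
have [||_ //] := @global_const (phi w) (phi' w) 0 (phi_X _).
- by apply: phi'_Y; left.
- by rewrite rmorph0 mulr0 subr0 phi_eq.
Qed.

Lemma kzb_form_nil : kzb_form P [::] = 0.
Proof. by rewrite /kzb_form exp_ad_nil /serB /Defs.monomial /= !scale0r addr0. Qed.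

Lemma kzb_form_A : kzb_form P [:: true] = alpha C.
Proof. by rewrite /kzb_form exp_ad_A serB_degA // scale0r scale1r add0r. Qed.

(* Horizontality of phi on w, once phi vanishes on longer words starting with A,
   reads phi(Aw) alpha = 0. *)
Lemma phi_A w : phi (true :: w) = 0.
Proof.
have [k] := ubnP (n.+1 - size w)%N; elim: k w => // k IH w wk.
have [wn|wn] := leqP (size (true :: w)) n; last first.
  by apply: phi_out => -[]; rewrite leqNgt wn.
have [wm|wm] := leqP m (degA (true :: w)).
  by apply: phi_out => -[_]; rewrite ltnNge wm.
have {}wn : (size w < n)%N := wn.
have {}wm : ((degA w).+1 < m)%N := wm.
have IH' w' : (size w < size w')%N -> phi (true :: w') = 0.
  by move=> ww; apply: IH; lia.
have [u [Gu tu uv]] := phi_lift (ltnW wn) (ltnW wm).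
have uE w' : (size w' <= n)%N -> u w' = (w' == w)%:R.
  by move=> wn'; rewrite -monomial_eq -tu /trunc wn'.
have := lf_transverse (plf_X G_plf) Gu.
(* Transversality loses one filtration step; since [deg_A w + 2 <= m], the result still lies in step
   [1 - m], where the relation for [phi] holds. *)
have rel u' : G (- (degA w)%:Z - 1) u' -> u' v = \sum_(w <- words n) phi w * u' w.
  by move=> Gu'; apply: phi_rel; apply: (G_dec _ Gu'); lia.
move=> /(tensor_relation rel).
have conn w' : (size w' <= n.+1)%N -> connection (kzb_form P) n.+1 u w'
    = d (u w') - \sum_(i < size w') (u (drop i.+1 w') : L) *: kzb_form P (take i.+1 w').
  move=> wn'; rewrite /connection /trunc wn' big_ord_recl take0 kzb_form_nil.
  by rewrite scaler0 add0r.
rewrite conn ?v_size // uv; have [c ->] := phi_const w; rewrite ec_d_const.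
(* At [v] only a suffix equal to [w] could contribute; the prefix before it has A-degree at least 2,
   where the form vanishes. As [phi w] is constant, the whole left side is 0. *)
rewrite big1 ?subr0 => [|i _]; last first.
  rewrite uE; last by rewrite size_drop; have := ltn_ord i; lia.
  case: eqP => [e|_]; last by rewrite scale0r.
  rewrite kzb_form_degA ?scaler0 //; have := degA_split i.+1 v; rewrite e; lia.
rewrite (@sum_words_supp _ _ _ [:: true :: w]) //.
- rewrite big_seq1 conn /=; last by rewrite ltnW.
  rewrite uE // (_ : (true :: w == w) = false) ?ec_d0; last first.
    by apply/eqP => e; have := congr1 (@size letter) e; rewrite /=; lia.
  rewrite big_ord_recl /= drop0 take0 kzb_form_A uE ?eqxx ?scale1r; last lia.
  rewrite big1 ?addr0 ?sub0r => [|i _]; last first.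
    rewrite /bump leq0n add1n /= uE; last by rewrite size_drop; lia.
    case: eqP => [e|_]; last by rewrite scale0r.
    have iw : (i < size w)%N := ltn_ord i.
    by have := congr1 (@size letter) e; rewrite size_drop; lia.
  move/esym/eqP; rewrite scalerN oppr_eq0 scaler_eq0 (negbTE (alpha_neq0 C K0)) orbF.
  by move/eqP.
(* The other words drop out: [phi] vanishes on words starting with B and, by induction, on Aw' with
   w' longer than [w]. If w' is no longer than [w] and differs from it, [w] is not a suffix of w',
   and only derivatives of constants remain. *)
- move=> w' wn'; rewrite mem_seq1 => ww'.
  case: w' wn' ww' => [|[] w'] wn' ww'.
  + rewrite conn // big_ord0 subr0 uE //.
    by case: eqP => _; rewrite ?ec_d1 ?ec_d0 scaler0.
  + have {}wn' : (size w' < n)%N := wn'.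
    have [ww|ww] := ltnP (size w) (size w'); first by rewrite IH' // scale0r.
    rewrite conn; last by rewrite /= ltnW.
    rewrite big1 ?subr0 => [|i _].
      by rewrite uE //; case: eqP => _; rewrite ?ec_d1 ?ec_d0 scaler0.
    rewrite uE /=; last by rewrite size_drop; exact: leq_trans (leq_subr _ _) (ltnW wn').
    case: eqP => [e|_]; last by rewrite scale0r.
    have := congr1 (@size letter) e; rewrite size_drop => sz.
    have i0 : nat_of_ord i = 0%N.
      have iw : (i < (@size letter w').+1)%N := ltn_ord i.
      have {}ww : (@size letter w' <= @size letter w)%N := ww.
      have {}sz : (@size letter w' - i)%N = @size letter w := sz.
      by lia.
    by move: e ww'; rewrite i0 drop0 => ->; rewrite eqxx.
  + by rewrite phi_eq phi'_B scale0r.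
- by move=> w'; rewrite mem_seq1 => /eqP ->; rewrite ltnNge wn.
Qed.

(** On the marked section, which lies in step [1 - m] once [m > 0], the relation reduces to [u v =
    phi [::] * u [::]]. At b the left side is 0 and [u [::]] is 1, so the constant [phi [::]]
    vanishes. *)
Lemma phi_nil : phi [::] = 0.
Proof.
have [m0|m0] := posnP m; first by apply: phi_out => -[_]; rewrite m0.
have [u Gu ub] := plf_pointed G_plf.
have uv : u v = phi [::] * u [::].
  rewrite phi_rel; last by apply: (G_dec _ Gu); lia.
  rewrite (@sum_words_supp _ _ _ [:: [::]]) ?big_seq1 //.
    move=> [|[] w'] _ //; first by rewrite phi_A mul0r.
    by rewrite phi_eq phi'_B mul0r.
  by move=> w'; rewrite mem_seq1 => /eqP ->.
have [c ec] := phi_const [::].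
have := ub v; rewrite uv ec; have -> : (v == [::]) = false by rewrite -size_eq0 v_size.
move=> vb; have := value_at_scale K0 b_on_X vb (ub [::]).
by rewrite /= mulr1 => <-; rewrite rmorph0.
Qed.

Lemma phi_eq0 w : phi w = 0.
Proof.
by case: w => [|[] w]; [exact: phi_nil|exact: phi_A|rewrite phi_eq phi'_B].
Qed.

End Coefficient.

Lemma coef_eq0 v : size v = n.+1 ->
  (forall j u, G j u -> - j < (degA v)%:Z -> u v = 0) /\
  (forall j u, G' j u -> - j < (degA v)%:Z -> u v = 0).
Proof.
move=> vn; have GX := plf_X G_plf; have GY := plf_Y G_plf.
have subX j := (lf_subbundle GX j).1; have subY j := (lf_subbundle GY j).1.
have [phi [R1 O1 L1 E1]] := lift_functional subX (lf_decreasing GX) G_ker G_quot vn.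
have [phi' [R2 O2 L2 E2]] := lift_functional subY (lf_decreasing GY) G'_ker G'_quot vn.
have z w : phi w = 0 by exact: (phi_eq0 vn R1 R2 O1 O2 L1 E1 E2).
have z' w : phi' w = 0.
  by rewrite -(phi_eq vn R1 R2 O1 O2 L1 E2).
split=> j u Gu jv.
  rewrite E1; last by apply: (lf_decreasing GX _ Gu); lia.
  by rewrite big1 // => w _; rewrite z mul0r.
rewrite E2; last by apply: (lf_decreasing GY _ Gu); lia.
by rewrite big1 // => w _; rewrite z' mul0r.
Qed.

Lemma hodge_step :
  (forall j, G j = word_fil X n.+1 j) /\ (forall j, G' j = word_fil Y n.+1 j).
Proof.
have GX := plf_X G_plf; have GY := plf_Y G_plf.
have subX j := (lf_subbundle GX j).1; have subY j := (lf_subbundle GY j).1.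
split; apply: graph_zero => // j u v Gu vn jv; have [H1 H2] := coef_eq0 vn.
  exact: (H1 j).
exact: (H2 j).
Qed.

End Step.

(** At level 0 the bundle coincides with its kernel part, so exactness alone determines the
    filtration. *)
Lemma hodge_level0 U (G : int -> set ncs) : (forall j, G j `<=` level (sections U) 0) ->
  (forall j, G j `&` [set u | forall w, size w <> 0%N -> u w = 0] = tensor_power_fil U 0 j) ->
  forall j, G j = word_fil U 0 j.
Proof.
move=> Glev Gker j; have E : tensor_power_fil U 0 j = word_fil U 0 j.
  congr (Defs.span _ [set monomial w | w in _]); apply/seteqP.
  by split=> w /= [w0 wj]; split=> //; [rewrite w0|apply/eqP; rewrite -leqn0].
rewrite -E -Gker; apply/seteqP; split=> [u Gu|u []//]; split=> // w w0.
by have /levelP[_ ->] := Glev _ _ Gu; rewrite // lt0n; exact/eqP.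
Qed.

Lemma hodge_filtration_unique (F : nat -> int -> set ncs) :
  is_hodge_filtration P f b1 b2 F -> F = @word_filtration K C.
Proof.
move=> [F' [plf [Xker Xquot] [Yker Yquot]]].
(* Both charts are carried through the induction: the step needs the quotient filtration over Y as
   well as over X. *)
suff H n : (forall j, F n j = word_fil X n j) /\ (forall j, F' n j = word_fil Y n j).
  by apply/funext => n; apply/funext => j; have [-> _] := H n.
elim: n => [|n [IHX IHY]].
  split; apply: hodge_level0 => // j u Fu.
    exact: (submod_sub (lf_subbundle (plf_X (plf 0%N)) j).1).
  exact: (submod_sub (lf_subbundle (plf_Y (plf 0%N)) j).1).
apply: (hodge_step (plf n.+1)) => // j; first by rewrite Xquot.
by rewrite Yquot.
Qed.

End Uniqueness.

Theorem proposition6 (K : fieldType) (v : K -> int)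
    (K_local : nonarch_local_field v) (K_char0 : [pchar K] =i pred0)
    (E : weierstrass_curve K) (E_good : good_reduction v (ec_e E 4) (ec_e E 6))
    (b1 b2 : K) (b_on_X : on_curve E b1 b2)
    (P : nat -> ec_L E) (P_def : is_P P)
    (f : ec_L E) (f_def : is_f f)
    (F : nat -> int -> set (series (ec_L E)^o)) :
  is_hodge_filtration P f b1 b2 F <-> F = @word_filtration K E.
Proof.
split; first exact: hodge_filtration_unique.
by move=> ->; exact: word_filtration_hodge.
Qed.
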